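(* Let $(X,d)$ be a locally compact, geodesically complete CAT(0)-space which is connected at infinity, and fix $r>0$. Let $d'$ be a metric on $X$ such that $(X,d')$ is a locally compact, geodesically complete CAT(0)-space. Then the following three conditions are equivalent: (1) for all $x,y\in X$: $d(x,y)\le r \iff d'(x,y)\le r$; (2) for all $x,y\in X$: $d(x,y)=r \iff d'(x,y)=r$; (3) for all $x,y\in X$: $d(x,y)<r \iff d'(x,y)<r$; and $d'(x,y)=d(x,y)$ for all $x,y\in X$ if and only if any one of them holds.
   Context: A metric space is geodesically complete if it is geodesic and every geodesic segment is contained in a complete geodesic $\mathbb R\to X$. $X$ is connected at infinity if the complement of every metric ball is path connected. *)

(* Defs.v *)
(* concrete reals R. A "metric on X" is a function d : X -> X -> R;
   all topological notions are taken w.r.t. the metric passed as argument,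
   since d and d' may a priori induce different topologies. *)
From Stdlib Require Import Reals List.
Open Scope R_scope.

Section MetricDefs.
Context {X : Type}.

Definition is_metric (d : X -> X -> R) : Prop :=
  (forall x y, 0 <= d x y) /\
  (forall x y, d x y = 0 <-> x = y) /\
  (forall x y, d x y = d y x) /\
  (forall x y z, d x z <= d x y + d y z).

Definition geod_seg (d : X -> X -> R) (c : R -> X) (a b : R) : Prop :=
  a <= b /\
  forall s t, a <= s <= b -> a <= t <= b -> d (c s) (c t) = Rabs (s - t).

Definition geod_line (d : X -> X -> R) (g : R -> X) : Prop :=
  forall s t, d (g s) (g t) = Rabs (s - t).

Definition geodesic_space (d : X -> X -> R) : Prop :=
  forall x y, exists c : R -> X,
    geod_seg d c 0 (d x y) /\ c 0 = x /\ c (d x y) = y.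

Definition geodesically_complete (d : X -> X -> R) : Prop :=
  geodesic_space d /\
  forall (c : R -> X) (a b : R), geod_seg d c a b ->
    exists g : R -> X, geod_line d g /\
      forall t, a <= t <= b -> exists s, g s = c t.

Definition euclid (p q : R * R) : R :=
  sqrt ((fst p - fst q) ^ 2 + (snd p - snd q) ^ 2).

Definition cmp_pt (ai aj : R * R) (L t : R) : R * R :=
  (fst ai + (t / L) * (fst aj - fst ai), snd ai + (t / L) * (snd aj - snd ai)).

(* CAT(0) inequality (Bridson--Haefliger II.1.1): for every geodesic triangle and
   every Euclidean comparison triangle, distances between points on the triangle are
   at most the distances of the comparison points. A side is (c, a_i, a_j, L) with
   c a geodesic parametrized by arc length on [0, L]. *)
Definition CAT0 (d : X -> X -> R) : Prop :=
  geodesic_space d /\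
  forall (x1 x2 x3 : X) (c12 c23 c31 : R -> X) (a1 a2 a3 : R * R),
    geod_seg d c12 0 (d x1 x2) -> c12 0 = x1 -> c12 (d x1 x2) = x2 ->
    geod_seg d c23 0 (d x2 x3) -> c23 0 = x2 -> c23 (d x2 x3) = x3 ->
    geod_seg d c31 0 (d x3 x1) -> c31 0 = x3 -> c31 (d x3 x1) = x1 ->
    euclid a1 a2 = d x1 x2 -> euclid a2 a3 = d x2 x3 -> euclid a3 a1 = d x3 x1 ->
    let sides := (c12, a1, a2, d x1 x2) :: (c23, a2, a3, d x2 x3)
                 :: (c31, a3, a1, d x3 x1) :: nil in
    forall c ai aj L c' ai' aj' L' t t',
      In (c, ai, aj, L) sides -> In (c', ai', aj', L') sides ->
      0 <= t <= L -> 0 <= t' <= L' ->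
      d (c t) (c' t') <= euclid (cmp_pt ai aj L t) (cmp_pt ai' aj' L' t').

Definition open_ball (d : X -> X -> R) (x : X) (e : R) : X -> Prop :=
  fun y => d x y < e.

Definition d_open (d : X -> X -> R) (U : X -> Prop) : Prop :=
  forall x, U x -> exists e, 0 < e /\ forall y, open_ball d x e y -> U y.

Definition d_compact (d : X -> X -> R) (K : X -> Prop) : Prop :=
  forall (I : Type) (U : I -> X -> Prop),
    (forall i, d_open d (U i)) ->
    (forall x, K x -> exists i, U i x) ->
    exists l : list I, forall x, K x -> exists i, In i l /\ U i x.

Definition locally_compact (d : X -> X -> R) : Prop :=
  forall x, exists K : X -> Prop, d_compact d K /\
    exists e, 0 < e /\ forall y, open_ball d x e y -> K y.

Definition d_path (d : X -> X -> R) (g : R -> X) : Prop :=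
  forall s, 0 <= s <= 1 -> forall e, 0 < e -> exists del, 0 < del /\
    forall t, 0 <= t <= 1 -> Rabs (t - s) < del -> d (g s) (g t) < e.

Definition path_connected (d : X -> X -> R) (S : X -> Prop) : Prop :=
  forall x y, S x -> S y -> exists g : R -> X, d_path d g /\ g 0 = x /\ g 1 = y /\
    forall t, 0 <= t <= 1 -> S (g t).

Definition connected_at_infinity (d : X -> X -> R) : Prop :=
  forall (x : X) (rho : R), 0 < rho ->
    path_connected d (fun y => ~ open_ball d x rho y).

End MetricDefs.

(* Main.v *)
Require Import Defs.
From Stdlib Require Import Reals Lra Lia Psatz ClassicalEpsilon FunctionalExtensionality.
Open Scope R_scope.

(** Each of (1) and (3) recovers the other, and with it all relations d <= n r and d < n r,
    from chains, common neighbours and geodesic extension.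

    From (2) to (1): as (X, d) is connected at infinity, its r-spheres are connected, so
    points at d-distance at most 2r have a common neighbour at distance r, and (2) gives
    d <= n r => d' <= n r.  For the converse one needs common neighbours for d'.  If every
    d'-geodesic avoiding a d'-ball of radius r had a constant projection to it, (X, d')
    would be a tree and some r-sphere would split into pieces at mutual distance 2r, which
    d-connectedness forbids.  Hence some r-sphere contains a nonconstant d'-path; points
    near a suitable place see an exact distance r to this path, so d is locally bounded
    there with respect to d', then everywhere, and d is bounded on d'-balls.  Thus a
    d-path far away for d stays far away for d', and joins the two ends of a d'-line
    through x and y; projecting it to the d'-sphere about x yields a common neighbour.

    From (1) and (3) to d = d': along a d-line g the points g(n r) form a ray for both
    metrics, and the Busemann functions b, b' of this ray satisfy b' = F o b with F
    increasing and F(s + r) = F(s) + r.  It suffices that F = id for all lines.  If b has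
    almost constant slope m on long segments, convexity of b and of b' along d'-straight
    samples gives F(x + m r) = F(x) + m r.  If some m in (-1, 1) occurs, nearly flat
    triangles with a vertex at infinity provide an interval of such m, whence F = id.
    Otherwise b changes quickly from slope -1 to slope 1 on every line.  By connectedness
    at infinity there are far points y with b(y) - b_-(y) = p for any given p, where b_- is
    the Busemann function of the opposite ray; near y both have slope almost 1 along the
    line from g(0) to y, and the flat strip argument shows that the increments of F and of
    the function F_- belonging to b_- agree there.  So F(x) - F_-(x - p) is constant for
    every p, F is additive, and F = id. *)

(** * Real functions *)

Lemma Rabs_le_between a b : Rabs a <= b <-> - b <= a <= b.
Proof. unfold Rabs; destruct (Rcase_abs a); lra. Qed.

Lemma Rabs_lt_between a b : Rabs a < b <-> - b < a < b.
Proof. unfold Rabs; destruct (Rcase_abs a); lra. Qed.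

(** The supremum m of the t such that [P] holds on all of [a, t] again satisfies [P], and local
    constancy at m leads beyond m unless m = b. *)
Lemma interval_connected (P : R -> Prop) (a b : R) :
  a <= b ->
  (forall s, a <= s <= b -> exists del, 0 < del /\
     forall t, a <= t <= b -> Rabs (t - s) < del -> (P s <-> P t)) ->
  P a -> P b.
Proof.
  intros Hab Hloc Pa.
  set (E := fun t => a <= t <= b /\ forall s, a <= s <= t -> P s).
  assert (HE : bound E) by (exists b; intros t [Ht _]; lra).
  assert (Ea : E a) by (split; [lra | intros s Hs; replace s with a by lra; exact Pa]).
  destruct (completeness E HE (ex_intro _ a Ea)) as [m [Hub Hlub]].
  assert (am : a <= m) by (apply Hub, Ea).
  assert (mb : m <= b) by (apply Hlub; intros t [Ht _]; lra).
  destruct (Hloc m (conj am mb)) as [del [Hdel Hm]].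
  assert (Hex : exists t, E t /\ m - del < t).
  { apply NNPP; intros Hn. assert (m <= m - del); [|lra].
    apply Hlub; intros t Et. apply Rnot_lt_le; intros Hlt. apply Hn; exists t; auto. }
  destruct Hex as [t [[Ht HPt] Hmt]].
  assert (tm : t <= m) by (apply Hub; split; auto).
  assert (Pm : P m).
  { apply (Hm t Ht); [apply Rabs_lt_between; lra|]. apply HPt; lra. }
  destruct (Req_dec m b) as [->|Hne]; [exact Pm|].
  assert (Emax : E (Rmin b (m + del / 2))).
  { pose proof (Rmin_l b (m + del / 2)). pose proof (Rmin_r b (m + del / 2)).
    split.
    - split; [apply Rmin_glb; lra | lra].
    - intros s Hs. destruct (Rle_dec s t) as [Hst|Hst]; [apply HPt; lra|].
      apply (Hm s); [lra | apply Rabs_lt_between; lra | exact Pm]. }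
  apply Hub in Emax. unfold Rmin in Emax. destruct (Rle_dec b (m + del / 2)); lra.
Qed.

Definition cont_on (f : R -> R) (a b : R) : Prop :=
  forall s, a <= s <= b -> forall e, 0 < e -> exists del, 0 < del /\
    forall t, a <= t <= b -> Rabs (t - s) < del -> Rabs (f t - f s) < e.

Lemma ivt_avoid (f : R -> R) (a b v : R) :
  a <= b -> cont_on f a b -> (forall t, a <= t <= b -> f t <> v) -> f a < v -> f b < v.
Proof.
  intros Hab Hc Hv Ha.
  apply (interval_connected (fun t => f t < v) a b Hab); [|exact Ha].
  intros s Hs. specialize (Hv s Hs) as Hvs.
  destruct (Hc s Hs (Rabs (f s - v))) as [del [Hdel Hd]].
  { apply Rabs_pos_lt; lra. }
  exists del; split; [exact Hdel|]. intros t Ht Hts.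
  specialize (Hd t Ht Hts). apply Rabs_lt_between in Hd.
  unfold Rabs in Hd; destruct (Rcase_abs (f s - v)); lra.
Qed.

Lemma ivt (f : R -> R) (a b v : R) :
  a <= b -> cont_on f a b -> f a <= v <= f b -> exists t, a <= t <= b /\ f t = v.
Proof.
  intros Hab Hc [Ha Hb]. apply NNPP; intros Hn.
  assert (Hv : forall t, a <= t <= b -> f t <> v)
    by (intros t Ht Heq; apply Hn; exists t; auto).
  assert (f a <> v) by (apply Hv; lra).
  assert (f b < v) by (apply (ivt_avoid f a b v); auto; lra).
  lra.
Qed.

Lemma ivt_dec (f : R -> R) (a b v : R) :
  a <= b -> cont_on f a b -> f b <= v <= f a -> exists t, a <= t <= b /\ f t = v.
Proof.
  intros Hab Hc Hv.
  destruct (ivt (fun t => - f t) a b (- v) Hab) as [t [Ht Heq]].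
  - intros s Hs e He. destruct (Hc s Hs e He) as [del [Hdel Hd]].
    exists del; split; [exact Hdel|]. intros t Ht Hts.
    replace (- f t - - f s) with (- (f t - f s)) by ring. rewrite Rabs_Ropp. auto.
  - lra.
  - exists t; split; [exact Ht | lra].
Qed.

Lemma lipschitz_cont_on (f : R -> R) (K a b : R) :
  0 < K -> (forall s t, a <= s <= b -> a <= t <= b -> Rabs (f t - f s) <= K * Rabs (t - s)) ->
  cont_on f a b.
Proof.
  intros HK HL s Hs e He. exists (e / K). split; [apply Rdiv_lt_0_compat; lra|].
  intros t Ht Hts. apply Rle_lt_trans with (K * Rabs (t - s)); [auto|].
  apply Rmult_lt_compat_l with (r := K) in Hts; [|lra].
  replace (K * (e / K)) with e in Hts by (field; lra). exact Hts.
Qed.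

Lemma nat_above (x : R) : exists n : nat, x < INR n.
Proof.
  destruct (INR_unbounded x) as [n Hn]. exists n; lra.
Qed.

Lemma nat_floor (x : R) : 0 <= x -> exists n : nat, INR n <= x < INR n + 1.
Proof.
  intros Hx. destruct (nat_above x) as [N HN]. revert x Hx HN.
  induction N as [|N IH]; intros x Hx HN; [simpl in HN; lra|].
  rewrite S_INR in HN. destruct (Rlt_dec x (INR N)) as [H|H]; [auto|].
  exists N; lra.
Qed.

Lemma convex_seq_first (f : nat -> R) :
  (forall k, 2 * f (S k) <= f k + f (S (S k))) ->
  forall n, INR n * (f 1%nat - f 0%nat) <= f n - f 0%nat.
Proof.
  intros Hf.
  assert (Hinc : forall k, f 1%nat - f 0%nat <= f (S k) - f k).
  { induction k as [|k IH]; [lra|]. specialize (Hf k); lra. }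
  induction n as [|n IH]; [simpl; lra|].
  rewrite S_INR. specialize (Hinc n). lra.
Qed.

(** * Geodesically complete CAT(0) spaces *)

Section Space.
Context {X : Type}.

(* [had_stewart] compares the distance from x to a point z of the side pq with the one
   given by Stewart's theorem in the Euclidean comparison triangle. *)
Record hadamard (d : X -> X -> R) : Prop := {
  had_pos : forall x y, 0 <= d x y;
  had_eq0 : forall x y, d x y = 0 -> x = y;
  had_refl : forall x, d x x = 0;
  had_sym : forall x y, d x y = d y x;
  had_tri : forall x y z, d x z <= d x y + d y z;
  had_line : forall x y, exists g, geod_line d g /\ g 0 = x /\ g (d x y) = y;
  had_stewart : forall x p q z s t,
    d p z = s -> d z q = t -> d p q = s + t ->
    (s + t) * (d x z)^2 <= t * (d x p)^2 + s * (d x q)^2 - s * t * (s + t)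
}.

(** Geodesic completeness only puts the image of a segment on a line; the parameter of that line is
    shifted and, if it runs from y to x, reversed. *)
Lemma geod_line_extends (d : X -> X -> R) (x y : X) :
  is_metric d -> geodesically_complete d ->
  exists g, geod_line d g /\ g 0 = x /\ g (d x y) = y.
Proof.
  intros (Hpos & Heq & Hsym & Htri) [Hgeo Hext].
  destruct (Hgeo x y) as [c [Hc [c0 c1]]].
  destruct (Hext c 0 (d x y) Hc) as [g [Hg Hgc]].
  pose proof (Hpos x y) as Hxy.
  destruct (Hgc 0) as [s0 Hs0]; [lra|]. destruct (Hgc (d x y)) as [s1 Hs1]; [lra|].
  rewrite c0 in Hs0. rewrite c1 in Hs1.
  assert (Habs : Rabs (s1 - s0) = d x y) by (rewrite <- Hg, Hs0, Hs1; apply Hsym).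
  destruct (Rle_dec s0 s1) as [Hle|Hle].
  - rewrite Rabs_right in Habs by lra.
    exists (fun t => g (s0 + t)). repeat split.
    + intros s t. rewrite Hg. f_equal; ring.
    + rewrite Rplus_0_r; exact Hs0.
    + rewrite <- Habs. replace (s0 + (s1 - s0)) with s1 by ring. exact Hs1.
  - rewrite Rabs_left in Habs by lra.
    exists (fun t => g (s0 - t)). repeat split.
    + intros s t. rewrite Hg. rewrite <- Rabs_Ropp. f_equal; ring.
    + rewrite Rminus_0_r; exact Hs0.
    + rewrite <- Habs. replace (s0 - - (s1 - s0)) with s1 by ring. exact Hs1.
Qed.

Lemma sqrt_eq_sq (a b : R) : 0 <= b -> a = b ^ 2 -> sqrt a = b.
Proof. intros Hb ->. apply sqrt_pow2; exact Hb. Qed.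

Lemma sq_le_of_le_sqrt (a b : R) : 0 <= a -> 0 <= b -> a <= sqrt b -> a ^ 2 <= b.
Proof.
  intros Ha Hb H. rewrite <- (pow2_sqrt b Hb). apply pow_incr; auto.
Qed.

Lemma comparison_triangle (a b c : R) :
  0 < a -> 0 <= b -> 0 <= c -> a <= b + c -> b <= a + c -> c <= a + b ->
  exists u v, u ^ 2 + v ^ 2 = b ^ 2 /\ (u - a) ^ 2 + v ^ 2 = c ^ 2.
Proof.
  intros Ha Hb Hc H1 H2 H3.
  (* The law of cosines gives the foot of the altitude; the triangle inequalities say that it lies
     in [-b, b]. *)
  set (u := (b ^ 2 + a ^ 2 - c ^ 2) / (2 * a)).
  assert (Hu : 2 * a * u = b ^ 2 + a ^ 2 - c ^ 2) by (unfold u; field; lra).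
  assert (Hub : - b <= u <= b).
  { split; apply Rmult_le_reg_l with (2 * a); nra. }
  exists u, (sqrt (b ^ 2 - u ^ 2)).
  rewrite pow2_sqrt by nra. split; [ring | nra].
Qed.

Lemma stewart_geodesic (d : X -> X -> R) (x p q : X) (c : R -> X) (s : R) :
  is_metric d -> CAT0 d ->
  geod_seg d c 0 (d p q) -> c 0 = p -> c (d p q) = q -> 0 <= s <= d p q -> 0 < d p q ->
  d p q * (d x (c s))^2 <=
    (d p q - s) * (d x p)^2 + s * (d x q)^2 - s * (d p q - s) * d p q.
Proof.
  intros (Hpos & Heq & Hsym & Htri) [Hgeo Hcmp] Hc c0 cL Hs HL.
  destruct (Hgeo q x) as [c23 [Hc23 [c230 c231]]].
  destruct (Hgeo x p) as [c31 [Hc31 [c310 c311]]].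
  set (L := d p q) in *.
  destruct (comparison_triangle L (d x p) (d q x)) as [u [v [Huv1 Huv2]]]; auto.
  { rewrite (Hsym x p), (Hsym q x). unfold L.
    pose proof (Htri p x q). lra. }
  { rewrite (Hsym x p), (Hsym q x). unfold L.
    pose proof (Htri p q x). rewrite (Hsym q x) in H. lra. }
  { unfold L. pose proof (Htri q p x). rewrite (Hsym q p), (Hsym p x) in H. lra. }
  assert (E1 : euclid (0, 0) (L, 0) = d p q).
  { unfold euclid; simpl. apply sqrt_eq_sq; [auto|]. fold L; ring. }
  assert (E2 : euclid (L, 0) (u, v) = d q x).
  { unfold euclid; simpl. apply sqrt_eq_sq; [auto|]. rewrite <- Huv2; ring. }
  assert (E3 : euclid (u, v) (0, 0) = d x p).
  { unfold euclid; simpl. apply sqrt_eq_sq; [auto|]. rewrite <- Huv1; ring. }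
  (* The vertex x is the point with parameter 0 on the side from x to p; its comparison point is (u,
     v) even if this side has length 0, because 0 / 0 = 0. *)
  assert (Hd : d (c s) (c31 0) <=
      euclid (cmp_pt (0, 0) (L, 0) L s) (cmp_pt (u, v) (0, 0) (d x p) 0)).
  { refine (Hcmp p q x c c23 c31 (0, 0) (L, 0) (u, v) Hc c0 cL Hc23 c230 c231
              Hc31 c310 c311 E1 E2 E3 _ _ _ _ _ _ _ _ _ _ _ _ _ _).
    - left; reflexivity.
    - right; right; left; reflexivity.
    - exact Hs.
    - pose proof (Hpos x p); lra. }
  rewrite c310 in Hd. unfold euclid, cmp_pt in Hd; simpl in Hd.
  rewrite Hsym.
  match type of Hd with _ <= sqrt ?e => assert (Hsq : (d (c s) x)^2 <= e) end.
  { apply sq_le_of_le_sqrt; [auto | | exact Hd].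
    apply Rplus_le_le_0_compat; rewrite Rmult_1_r; apply Rle_0_sqr. }
  replace (0 + s / L * (L - 0)) with s in Hsq by (field; lra).
  replace (0 / d x p) with 0 in Hsq by (unfold Rdiv; ring).
  rewrite (Hsym q x) in Huv2.
  clear Hd Hcmp. set (D := d (c s) x) in *. set (A := d x p) in *. set (B := d x q) in *.
  assert (E : D ^ 2 <= s ^ 2 - 2 * s * u + A ^ 2) by nra.
  assert (2 * L * u = A ^ 2 + L ^ 2 - B ^ 2) by nra.
  apply Rmult_le_compat_l with (r := L) in E; [|lra]. nra.
Qed.

Lemma hadamard_of_CAT0 (d : X -> X -> R) :
  is_metric d -> geodesically_complete d -> CAT0 d -> hadamard d.
Proof.
  intros Hm Hgc Hcat.
  pose proof Hm as (Hpos & Heq & Hsym & Htri).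
  assert (Hrefl : forall x, d x x = 0) by (intros x; apply Heq; reflexivity).
  constructor; auto; [intros x y; apply Heq | | ].
  { intros x y. apply geod_line_extends; assumption. }
  intros x p q z s t Hs Ht Hst.
  pose proof (Hpos p z) as Hs0. pose proof (Hpos z q) as Ht0.
  rewrite Hs in Hs0. rewrite Ht in Ht0.
  destruct (Req_dec (s + t) 0) as [H0|H0].
  { replace s with 0 by lra. replace t with 0 by lra. lra. }
  assert (HL : 0 < d p q) by lra.
  destruct (proj1 Hcat p q) as [c [Hc [c0 cL]]].
  assert (Hcs : forall w, (s + t) * (d w (c s))^2 <=
      t * (d w p)^2 + s * (d w q)^2 - s * t * (s + t)).
  { intros w. pose proof (stewart_geodesic d w p q c s Hm Hcat Hc c0 cL) as HS.
    rewrite Hst in HS. replace (s + t - s) with t in HS by ring. apply HS; lra. }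
  (* For the point z itself the right-hand side is t s^2 + s t^2 - s t (s + t) = 0. *)
  assert (Hz : z = c s).
  { apply Heq. pose proof (Hcs z) as Hz. rewrite (Hsym z p), Hs, Ht in Hz.
    assert (Hz2 : (s + t) * (d z (c s))^2 <= 0) by nra.
    assert (0 <= (d z (c s)) ^ 2) by nra.
    assert ((d z (c s)) ^ 2 = 0) by nra. nra. }
  rewrite Hz. apply Hcs.
Qed.

End Space.

Arguments had_pos {X d}. Arguments had_eq0 {X d}. Arguments had_refl {X d}.
Arguments had_sym {X d}. Arguments had_tri {X d}. Arguments had_line {X d}.
Arguments had_stewart {X d}.

(** * Convexity of the distance, comparison inequalities and projection to balls *)

Definition convex_fun (u : R -> R) : Prop :=
  forall a b c, a <= b <= c -> (c - a) * u b <= (c - b) * u a + (b - a) * u c.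

(** Both chord slopes are compared with the slope of the chord from a to e; the two intervals may
    overlap. *)
Lemma convex_chords (u : R -> R) (a b c e : R) :
  convex_fun u -> a < b -> c < e -> a <= c -> b <= e ->
  (u b - u a) * (e - c) <= (u e - u c) * (b - a).
Proof.
  intros Hu Hab Hce Hac Hbe.
  assert (H1 : (u b - u a) * (e - a) <= (u e - u a) * (b - a))
    by (pose proof (Hu a b e); nra).
  assert (H2 : (u e - u a) * (e - c) <= (u e - u c) * (e - a))
    by (pose proof (Hu a c e); nra).
  apply Rmult_le_reg_r with (e - a); [lra|].
  apply Rle_trans with ((u e - u a) * (b - a) * (e - c)).
  - apply Rmult_le_compat_r with (r := e - c) in H1; lra.
  - apply Rmult_le_compat_r with (r := b - a) in H2; lra.
Qed.

Section Space.
Context {X : Type} (d : X -> X -> R) (H : hadamard d).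

Local Notation dpos := (had_pos H).
Local Notation dsym := (had_sym H).
Local Notation dtri := (had_tri H).

Lemma dist_rev_tri x y z : Rabs (d x y - d x z) <= d y z.
Proof.
  apply Rabs_le_between. pose proof (dtri x y z). pose proof (dtri x z y).
  rewrite (dsym z y) in *. lra.
Qed.

Lemma between_unique p q z z' s t :
  d p z = s -> d z q = t -> d p z' = s -> d z' q = t -> d p q = s + t -> z = z'.
Proof.
  intros H1 H2 H3 H4 H5.
  pose proof (dpos p z) as Hs. pose proof (dpos z q) as Ht. pose proof (dpos z' z) as Hp.
  rewrite H1 in Hs. rewrite H2 in Ht.
  destruct (Req_dec (s + t) 0) as [E|E].
  - assert (p = z) by (apply (had_eq0 H); lra).
    assert (p = z') by (apply (had_eq0 H); lra). congruence.
  - pose proof (had_stewart H z' p q z s t H1 H2 H5) as HS.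
    rewrite (dsym z' p), H3, H4 in HS.
    assert (Hz : (s + t) * d z' z ^ 2 <= 0) by nra.
    assert (d z' z ^ 2 <= 0) by (apply Rmult_le_reg_l with (s + t); lra).
    assert (d z' z = 0) by nra. symmetry; apply (had_eq0 H); assumption.
Qed.

Definition geod_convex (f : X -> R) : Prop :=
  forall p q z s t, d p z = s -> d z q = t -> d p q = s + t ->
    (s + t) * f z <= t * f p + s * f q.

(** With A = d x p and B = d x q, (s + t) (t A^2 + s B^2) exceeds (t A + s B)^2 by s t (A - B)^2,
    and |A - B| <= s + t lets the last term of Stewart's inequality absorb this. *)
Lemma dist_geod_convex x : geod_convex (d x).
Proof.
  intros p q z s t H1 H2 H3.
  pose proof (had_stewart H x p q z s t H1 H2 H3) as HS.
  pose proof (dpos p z) as Hs. pose proof (dpos z q) as Ht. rewrite H1 in Hs. rewrite H2 in Ht.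
  pose proof (dist_rev_tri x p q) as HL. apply Rabs_le_between in HL. rewrite H3 in HL.
  pose proof (dpos x z) as Hz. pose proof (dpos x p) as Hp. pose proof (dpos x q) as Hq.
  set (D := d x z) in *. set (A := d x p) in *. set (B := d x q) in *.
  assert (Hsq : (A - B) ^ 2 <= (s + t) ^ 2) by nra.
  apply Rnot_lt_le; intros Hlt.
  assert (0 <= t * A + s * B) by nra.
  assert (((s + t) * D) ^ 2 > (t * A + s * B) ^ 2) by nra.
  assert ((s + t) * ((s + t) * D ^ 2) <= (s + t) * (t * A ^ 2 + s * B ^ 2 - s * t * (s + t)))
    by (apply Rmult_le_compat_l; lra).
  assert (s * t * (A - B) ^ 2 <= s * t * (s + t) ^ 2)
    by (apply Rmult_le_compat_l; nra).
  nra.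
Qed.

Lemma convex_on_line f g : geod_convex f -> geod_line d g -> convex_fun (fun s => f (g s)).
Proof.
  intros Hf Hg a b c Habc.
  pose proof (Hf (g a) (g c) (g b) (b - a) (c - b)) as HH.
  rewrite !Hg in HH. rewrite !Rabs_left1 in HH by lra.
  specialize (HH ltac:(ring) ltac:(ring) ltac:(ring)).
  replace (b - a + (c - b)) with (c - a) in HH by ring. exact HH.
Qed.

(** Stewart's inequality is applied to z' and the side pq, then to q and the side pq'; the squares
    of both sides cancel. Division by the side lengths makes the degenerate cases separate. *)
Lemma thales p q q' z z' l :
  0 <= l <= 1 -> d p z = l * d p q -> d z q = (1 - l) * d p q ->
  d p z' = l * d p q' -> d z' q' = (1 - l) * d p q' -> d z z' <= l * d q q'.
Proof.
  intros Hl H1 H2 H3 H4.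
  assert (S1 : d p q * (d z' z)^2 <=
     d p q * ((1 - l) * (d p z')^2 + l * (d z' q)^2 - l * (1 - l) * (d p q)^2)).
  { pose proof (had_stewart H z' p q z _ _ H1 H2 ltac:(ring)) as HS.
    rewrite (dsym z' p) in HS.
    match type of HS with ?a <= ?b => 
      apply Rle_trans with a; [apply Req_le; ring|apply Rle_trans with b; [exact HS|apply Req_le; ring]] end. }
  assert (S2 : d p q' * (d q z')^2 <=
     d p q' * ((1 - l) * (d p q)^2 + l * (d q q')^2 - l * (1 - l) * (d p q')^2)).
  { pose proof (had_stewart H q p q' z' _ _ H3 H4 ltac:(ring)) as HS.
    rewrite (dsym q p) in HS.
    match type of HS with ?a <= ?b => 
      apply Rle_trans with a; [apply Req_le; ring|apply Rle_trans with b; [exact HS|apply Req_le; ring]] end. }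
  pose proof (dpos p q) as Pq. pose proof (dpos p q') as Pq'. pose proof (dpos q q') as Pqq.
  pose proof (dpos z z') as Pz.
  rewrite (dsym z' z), (dsym z' q), H3 in S1.
  destruct (Req_dec (d p q) 0) as [E|E].
  { assert (p = q) by (apply (had_eq0 H); exact E).
    assert (p = z) by (apply (had_eq0 H); rewrite H1, E; ring).
    subst q z. rewrite H3. lra. }
  destruct (Req_dec (d p q') 0) as [E'|E'].
  { assert (p = q') by (apply (had_eq0 H); exact E').
    assert (p = z') by (apply (had_eq0 H); rewrite H3, E'; ring).
    subst q' z'. rewrite (dsym z p), H1, (dsym q p). lra. }
  apply Rmult_le_reg_l in S1; [|lra]. apply Rmult_le_reg_l in S2; [|lra].
  assert ((d z z') ^ 2 <= (l * d q q') ^ 2).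
  { apply Rmult_le_compat_l with (r := l) in S2; [|lra]. nra. }
  assert (0 <= l * d q q') by nra. nra.
Qed.

Lemma midpoint x y : exists m, d x m = d x y / 2 /\ d m y = d x y / 2.
Proof.
  destruct (had_line H x y) as [g [Hg [g0 g1]]].
  pose proof (dpos x y).
  exists (g (d x y / 2)). split.
  - rewrite <- g0 at 1. rewrite Hg, Rabs_left1; lra.
  - rewrite <- g1 at 2. rewrite Hg, Rabs_left1; lra.
Qed.

(** The midpoint m of the diagonal xp satisfies d y q <= d y m + d m q, and Stewart's inequality
    bounds both medians. *)
Lemma quadrilateral x p y q :
  (d x p)^2 + (d y q)^2 <= (d x y)^2 + (d y p)^2 + (d p q)^2 + (d q x)^2.
Proof.
  destruct (midpoint x p) as [m [M1 M2]].
  pose proof (dpos x p) as Hxp.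
  pose proof (had_stewart H y x p m _ _ M1 M2 ltac:(lra)) as S1.
  pose proof (had_stewart H q x p m _ _ M1 M2 ltac:(lra)) as S2.
  pose proof (dtri y m q) as HT. rewrite (dsym m q) in HT.
  pose proof (dpos y m). pose proof (dpos q m). pose proof (dpos y q).
  rewrite (dsym p q), (dsym x y).
  destruct (Req_dec (d x p) 0) as [E|E].
  { assert (x = p) by (apply (had_eq0 H); exact E). subst p.
    rewrite E. pose proof (dtri y x q) as HT'. rewrite (dsym x q) in HT'.
    pose proof (dpos y x). pose proof (dpos q x).
    assert ((d y q)^2 <= (d y x + d q x)^2) by (apply pow_incr; lra).
    pose proof (pow2_ge_0 (d y x - d q x)). nra. }
  assert (T1 : (d y m)^2 <= / 2 * (d y x)^2 + / 2 * (d y p)^2 - / 4 * (d x p)^2).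
  { apply Rmult_le_reg_l with (d x p); [lra|].
    eapply Rle_trans; [|eapply Rle_trans; [exact S1|]]; apply Req_le; field. }
  assert (T2 : (d q m)^2 <= / 2 * (d q x)^2 + / 2 * (d q p)^2 - / 4 * (d x p)^2).
  { apply Rmult_le_reg_l with (d x p); [lra|].
    eapply Rle_trans; [|eapply Rle_trans; [exact S2|]]; apply Req_le; field. }
  assert ((d y q)^2 <= 2 * (d y m)^2 + 2 * (d q m)^2).
  { assert ((d y q)^2 <= (d y m + d q m)^2) by (apply pow_incr; lra).
    pose proof (pow2_ge_0 (d y m - d q m)). nra. }
  nra.
Qed.

(** As a function of w with d x w >= s >= 0, this is the projection to the closed s-ball about x;
    for s outside [0, d x w] the value is arbitrary. *)
Definition toward (x w : X) (s : R) : X :=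
  epsilon (inhabits x) (fun z => d x z = s /\ d z w = d x w - s).

Lemma toward_spec x w s : 0 <= s <= d x w ->
  d x (toward x w s) = s /\ d (toward x w s) w = d x w - s.
Proof.
  intros Hs. unfold toward. apply epsilon_spec.
  destruct (had_line H x w) as [g [Hg [g0 g1]]].
  exists (g s). split.
  - rewrite <- g0 at 1. rewrite Hg, Rabs_left1; lra.
  - rewrite <- g1 at 1. rewrite Hg, Rabs_left1; lra.
Qed.

Lemma toward_unique x w s z : d x z = s -> d z w = d x w - s -> z = toward x w s.
Proof.
  intros H1 H2. pose proof (dpos x z). pose proof (dpos z w).
  destruct (toward_spec x w s) as [T1 T2]; [lra|].
  apply (between_unique x w z (toward x w s) s (d x w - s)); auto; lra.
Qed.

(** Cutting the longer geodesic to the length of the shorter at most doubles the distance of the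
    ends; [thales] then contracts. The constant 2 is enough for continuity. *)
Lemma toward_lipschitz_aux x w w' s :
  0 <= s <= d x w' -> d x w' <= d x w -> 
  d (toward x w s) (toward x w' s) <= 2 * d w w'.
Proof.
  intros Hs Hww.
  destruct (toward_spec x w s) as [A1 A2]; [lra|].
  destruct (toward_spec x w' s) as [B1 B2]; [lra|].
  destruct (toward_spec x w (d x w')) as [C1 C2]; [lra|].
  set (w1 := toward x w (d x w')) in *.
  assert (Hd : d w1 w' <= 2 * d w w').
  { pose proof (dtri w1 w w'). pose proof (dist_rev_tri x w w') as HR.
    apply Rabs_le_between in HR. lra. }
  destruct (Req_dec (d x w') 0) as [E|E].
  { assert (s = 0) by lra. subst s.
    assert (x = toward x w 0) by (apply (had_eq0 H); lra).
    assert (x = toward x w' 0) by (apply (had_eq0 H); lra).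
    rewrite <- H0, <- H1, (had_refl H). pose proof (dpos w w'). lra. }
  assert (Hz : toward x w s = toward x w1 s).
  { destruct (toward_spec x w1 s) as [D1 D2]; [lra|].
    symmetry. apply toward_unique; [exact D1|].
    pose proof (dtri (toward x w1 s) w1 w).
    pose proof (dtri x (toward x w1 s) w). lra. }
  destruct (toward_spec x w1 s) as [D1 D2]; [lra|].
  rewrite Hz in *. set (z := toward x w1 s) in *. set (z' := toward x w' s) in *.
  assert (Hl : 0 <= s / d x w' <= 1).
  { split; [apply Rmult_le_reg_r with (d x w') | apply Rmult_le_reg_r with (d x w')];
    try lra; unfold Rdiv; rewrite Rmult_assoc, Rinv_l by lra; lra. }
  apply Rle_trans with (s / d x w' * d w1 w').
  - apply (thales x w1 w' z z'); auto.
    + rewrite C1, D1. field; lra.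
    + rewrite D2, C1. field; lra.
    + rewrite B1. field; lra.
    + rewrite B2. field; lra.
  - pose proof (dpos w1 w'). nra.
Qed.

Lemma toward_lipschitz x w w' s :
  0 <= s <= d x w -> s <= d x w' ->
  d (toward x w s) (toward x w' s) <= 2 * d w w'.
Proof.
  intros Hs Hs'. destruct (Rle_dec (d x w') (d x w)) as [L|L].
  - apply toward_lipschitz_aux; lra.
  - rewrite dsym, (dsym w w'). apply toward_lipschitz_aux; lra.
Qed.

End Space.

Section Space.
Context {X : Type} {d : X -> X -> R} (H : hadamard d).

Local Notation dpos := (had_pos H).
Local Notation dsym := (had_sym H).
Local Notation dtri := (had_tri H).

Lemma extend_beyond x y s : 0 <= s -> exists z, d y z = s /\ d x z = d x y + s.
Proof.
  intros Hs. destruct (had_line H x y) as [g [Hg [g0 g1]]].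
  pose proof (dpos x y).
  exists (g (d x y + s)). split.
  - rewrite <- g1 at 1. rewrite Hg, Rabs_left1; lra.
  - rewrite <- g0 at 1. rewrite Hg, Rabs_left1; lra.
Qed.

Lemma line_dist g a b : geod_line d g -> a <= b -> d (g a) (g b) = b - a.
Proof. intros Hg Hab. rewrite Hg, Rabs_left1; lra. Qed.

Lemma shift_line g t : geod_line d g -> geod_line d (fun s => g (s + t)).
Proof. intros Hg a b. rewrite Hg. f_equal; ring. Qed.

Lemma flip_line g : geod_line d g -> geod_line d (fun s => g (- s)).
Proof. intros Hg a b. rewrite Hg, <- Rabs_Ropp. f_equal; ring. Qed.

Lemma dist_line_cont_on x g a b : geod_line d g -> cont_on (fun s => d x (g s)) a b.
Proof.
  intros Hg. apply lipschitz_cont_on with 1; [lra|]. intros s t _ _.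
  rewrite Rmult_1_l, <- (Hg t s). apply (dist_rev_tri d H).
Qed.

Lemma toward_line_cont_on x y g s a b :
  geod_line d g -> (forall t, a <= t <= b -> s <= d x (g t)) -> 0 <= s ->
  cont_on (fun t => d y (toward d x (g t) s)) a b.
Proof.
  intros Hg Hfar Hs. apply lipschitz_cont_on with 2; [lra|]. intros t t' Ht Ht'.
  eapply Rle_trans; [apply (dist_rev_tri d H)|].
  rewrite <- (Hg t' t). apply (toward_lipschitz d H); [split; [exact Hs|]|]; auto.
Qed.

Lemma path_cont_on x c : d_path d c -> cont_on (fun t => d x (c t)) 0 1.
Proof.
  intros Hc s Hs e He. destruct (Hc s Hs e He) as [del [Hdel Hd]].
  exists del; split; [exact Hdel|]. intros t Ht Hts.
  eapply Rle_lt_trans; [apply (dist_rev_tri d H)|]. rewrite dsym. auto.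
Qed.

Lemma toward_path x c s :
  d_path d c -> 0 <= s -> (forall t, 0 <= t <= 1 -> s <= d x (c t)) ->
  d_path d (fun t => toward d x (c t) s).
Proof.
  intros Hc Hs Hfar a Ha e He.
  destruct (Hc a Ha (e / 2)) as [del [Hdel Hd]]; [lra|].
  exists del; split; [exact Hdel|]. intros t Ht Hta. specialize (Hd t Ht Hta).
  eapply Rle_lt_trans; [apply (toward_lipschitz d H); [split; [exact Hs|]|]; auto|]. lra.
Qed.

Lemma outer_path x rho y z :
  connected_at_infinity d -> 0 < rho -> rho <= d x y -> rho <= d x z ->
  exists c, d_path d c /\ c 0 = y /\ c 1 = z /\ forall t, 0 <= t <= 1 -> rho <= d x (c t).
Proof.
  intros HC Hr Hy Hz.
  destruct (HC x rho Hr y z) as [c [Hc [c0 [c1 Hcf]]]]; try (unfold open_ball; lra).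
  exists c. repeat split; auto. intros t Ht. specialize (Hcf t Ht). unfold open_ball in Hcf. lra.
Qed.

(* The sphere of radius r about x is path connected, so the distance to y, which
   is small in the direction of y and large in the opposite one, is r somewhere on it. *)
Lemma common_neighbour r x y :
  connected_at_infinity d -> 0 < r -> d x y <= 2 * r -> exists z, d x z = r /\ d y z = r.
Proof.
  intros HC Hr Hxy. destruct (had_line H x y) as [g [Hg [g0 g1]]].
  pose proof (dpos x y) as Hp.
  assert (F1 : d x (g r) = r) by (rewrite <- g0, (line_dist g 0 r); auto; lra).
  assert (F2 : d x (g (- r)) = r)
    by (rewrite <- g0, dsym, (line_dist g (- r) 0); auto; lra).
  destruct (outer_path x r (g r) (g (- r))) as [c [Hc [c0 [c1 Hfar]]]]; auto; try lra.
  set (p := fun t => toward d x (c t) r).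
  assert (p0 : p 0 = g r).
  { unfold p; rewrite c0. symmetry; apply (toward_unique d H); [exact F1|].
    rewrite F1, (had_refl H); ring. }
  assert (p1 : p 1 = g (- r)).
  { unfold p; rewrite c1. symmetry; apply (toward_unique d H); [exact F2|].
    rewrite F2, (had_refl H); ring. }
  destruct (ivt (fun t => d y (p t)) 0 1 r) as [t [Ht Heq]]; [lra| |rewrite p0, p1; split|].
  - apply path_cont_on. apply toward_path; auto; lra.
  - rewrite <- g1, Hg. apply Rabs_le_between; lra.
  - rewrite <- g1, dsym, line_dist; auto; lra.
  - exists (p t). split; [|exact Heq]. unfold p.
    destruct (toward_spec d H x (c t) r) as [T _]; [split; [lra|auto]|exact T].
Qed.

End Space.

(** * Chains of short steps; closed and open r-balls determine each other *)

Section Balls.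
Context {X : Type} (r : R) (Hr : 0 < r).

Lemma near_chain (d d' : X -> X -> R) :
  hadamard d -> hadamard d' ->
  (forall x y, d x y <= r -> d' x y <= r) ->
  forall n x y, d x y <= INR n * r -> d' x y <= INR n * r.
Proof.
  intros H H' Hle. induction n as [|n IH]; intros x y Hxy.
  - simpl in *. pose proof (had_pos H x y).
    assert (x = y) by (apply (had_eq0 H); lra). subst y. rewrite (had_refl H'). lra.
  - rewrite S_INR in *. destruct (Rle_dec (d x y) r) as [L|L].
    + pose proof (Hle x y L). pose proof (pos_INR n). nra.
    + destruct (toward_spec d H x y r) as [T1 T2]; [lra|].
      pose proof (Hle x (toward d x y r)). pose proof (IH (toward d x y r) y).
      pose proof (had_tri H' x (toward d x y r) y). lra.
Qed.

Lemma near_chain_lt (d d' : X -> X -> R) :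
  hadamard d -> hadamard d' ->
  (forall x y, d x y < r -> d' x y < r) ->
  forall n x y, d x y < INR n * r -> d' x y < INR n * r.
Proof.
  intros H H' Hlt. induction n as [|n IH]; intros x y Hxy.
  - simpl in *. pose proof (had_pos H x y). lra.
  - rewrite S_INR in *. pose proof (pos_INR n) as Hn. pose proof (had_pos H x y) as Hp.
    (* Equal steps are all shorter than r, which steps of length r would not be. *)
    set (s := d x y / (INR n + 1)).
    assert (Hs : s * (INR n + 1) = d x y) by (unfold s; field; lra).
    assert (Hsr : s < r) by (apply Rmult_lt_reg_r with (INR n + 1); lra).
    assert (Hs0 : 0 <= s) by (apply Rmult_le_reg_r with (INR n + 1); lra).
    assert (s <= d x y) by nra.
    destruct (toward_spec d H x y s) as [T1 T2]; [lra|].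
    assert (d' x (toward d x y s) < r) by (apply Hlt; lra).
    (* A single step leaves distance 0, for which the strict induction hypothesis says nothing. *)
    destruct n as [|n].
    + simpl in *. assert (s = d x y) by lra.
      assert (toward d x y s = y) by (apply (had_eq0 H); lra). rewrite H3 in *. lra.
    + assert (d' (toward d x y s) y < INR (S n) * r).
      { apply IH. rewrite T2, <- Hs. replace (s * (INR (S n) + 1) - s) with (INR (S n) * s) by ring.
        apply Rmult_lt_compat_l; [|lra]. apply lt_0_INR; lia. }
      pose proof (had_tri H' x (toward d x y s) y). lra.
Qed.

(* d x y < 2r iff x and y have two distinct common neighbours at distance <= r *)
Lemma open_balls_of_closed (d d' : X -> X -> R) :
  hadamard d -> hadamard d' ->
  (forall x y, d x y <= r <-> d' x y <= r) ->
  forall x y, d x y < r -> d' x y < r.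
Proof.
  intros H H' HC x y Hxy. apply Rnot_le_lt; intros Hge.
  destruct (extend_beyond H' x y r) as [z [Z1 Z2]]; [lra|].
  assert (Hyz : d y z <= r) by (apply HC; lra).
  assert (Hxz : d x z < 2 * r) by (pose proof (had_tri H x y z); lra).
  destruct (midpoint d H x z) as [m [M1 M2]].
  (* The slack r - d x z / 2 > 0 gives a second point w within r of x and z; but d' x z >= 2r admits
     only one such point for d'. *)
  destruct (extend_beyond H x m (r - d x z / 2)) as [w [W1 _]]; [lra|].
  assert (Hne : m <> w).
  { intros E. subst w. rewrite (had_refl H) in W1. lra. }
  apply Hne.
  pose proof (had_tri H x m w). pose proof (had_tri H w m z). rewrite (had_sym H w m) in *.
  assert (A1 : d' x m <= r) by (apply HC; lra).
  assert (A2 : d' m z <= r) by (apply HC; lra).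
  assert (A3 : d' x w <= r) by (apply HC; lra).
  assert (A4 : d' w z <= r) by (apply HC; lra).
  pose proof (had_tri H' x m z). pose proof (had_tri H' x w z).
  apply (between_unique d' H' x z m w r r); lra.
Qed.

(** If d' x y > r, prolonging the d'-geodesic beyond y by slightly less than r gives z with d' x z >
    2r, although d y z < r forces d x z < 2r. *)
Lemma closed_balls_of_open (d d' : X -> X -> R) :
  hadamard d -> hadamard d' ->
  (forall x y, d x y < r <-> d' x y < r) ->
  forall x y, d x y <= r -> d' x y <= r.
Proof.
  intros H H' HC x y Hxy. apply Rnot_lt_le; intros Hlt.
  pose proof (near_chain_lt d d' H H' (fun x y => proj1 (HC x y)) 2 x) as H2. simpl in H2.
  set (e := Rmin r (d' x y - r)).
  assert (He : 0 < e <= r /\ e <= d' x y - r).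
  { unfold e. pose proof (Rmin_l r (d' x y - r)). pose proof (Rmin_r r (d' x y - r)).
    assert (0 < Rmin r (d' x y - r)) by (apply Rmin_glb_lt; lra). lra. }
  destruct (extend_beyond H' x y (r - e / 2)) as [z [Z1 Z2]]; [lra|].
  assert (d y z < r) by (apply HC; lra).
  pose proof (had_tri H x y z). specialize (H2 z). lra.
Qed.

End Balls.

(** * Equal spheres *)

Lemma le_of_pow2_approx (a b c : R) :
  0 <= c -> (forall n : nat, b - c / 2 ^ n <= a) -> b <= a.
Proof.
  intros Hc Hn. apply Rnot_lt_le; intros Hlt.
  destruct (nat_above (c / (b - a))) as [n Hn'].
  assert (Hp : INR n <= 2 ^ n).
  { clear. induction n as [|n IH]; [simpl; lra|].
    rewrite S_INR. simpl. assert (1 <= 2 ^ n) by (apply pow_R1_Rle; lra). lra. }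
  specialize (Hn n).
  assert (H2 : 0 < 2 ^ n) by (apply pow_lt; lra).
  assert (E : c / 2 ^ n * 2 ^ n = c) by (field; lra).
  assert (E' : c / (b - a) * (b - a) = c) by (field; lra).
  nra.
Qed.

(** * Branching of geodesics when projections to r-balls are constant *)

Section Branching.
Context {X : Type} {d : X -> X -> R} (H : hadamard d) (r : R) (Hr : 0 < r).

Local Notation dpos := (had_pos H).
Local Notation dsym := (had_sym H).
Local Notation dtri := (had_tri H).

(* Such a space is a tree: geodesics issuing from a common point are opposite or share
   an initial piece. *)
Definition constant_projections : Prop :=
  forall q g L, geod_line d g -> 0 <= L ->
    (forall t, 0 <= t <= L -> r <= d q (g t)) ->
    toward d q (g 0) r = toward d q (g L) r.

(** For a and b on the r-sphere about p: the geodesics from p to a and to b share their initial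
    piece of length k, ending at z. *)
Definition same_germ (p a b : X) : Prop :=
  exists k z, 0 < k <= r /\ d p z = k /\ d z a = r - k /\ d z b = r - k.

Lemma same_germ_refl p a : d p a = r -> same_germ p a a.
Proof.
  intros Ha. exists r, a. rewrite (had_refl H). repeat split; lra.
Qed.

Lemma same_germ_sym p a b : same_germ p a b -> same_germ p b a.
Proof. intros (k & z & Hk & H1 & H2 & H3). exists k, z. auto. Qed.

(** Both shared pieces lie on the geodesic from p to b, so the shorter one is shared by all three
    geodesics. *)
Lemma same_germ_trans p a b c :
  d p a = r -> d p b = r -> d p c = r ->
  same_germ p a b -> same_germ p b c -> same_germ p a c.
Proof.
  assert (Haux : forall a b c, d p b = r -> d p c = r -> forall k z k' z',
    0 < k <= r -> d p z = k -> d z a = r - k -> d z b = r - k ->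
    k <= k' <= r -> d p z' = k' -> d z' b = r - k' -> d z' c = r - k' ->
    same_germ p a c).
  { clear a b c. intros a b c Hb Hc k z k' z' Hk Z1 Z2 Z3 Hk' Y1 Y2 Y3.
    destruct (toward_spec d H p z' k) as [W1 W2]; [lra|].
    set (w := toward d p z' k) in *.
    pose proof (dtri w z' b). pose proof (dtri p w b).
    pose proof (dtri w z' c). pose proof (dtri p w c).
    assert (z = w) by (apply (between_unique d H p b z w k (r - k)); lra).
    subst z. exists k, w. repeat split; lra. }
  intros Ha Hb Hc (k & z & Hk & Z1 & Z2 & Z3) (k' & z' & Hk' & Y1 & Y2 & Y3).
  destruct (Rle_dec k k') as [L|L].
  - apply (Haux a b c Hb Hc k z k' z'); auto; lra.
  - apply same_germ_sym. apply (Haux c b a Hb Ha k' z' k z); auto; lra.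
Qed.

(** Seen from q = g (r + k), the segment of h over [0, k] stays outside the r-ball, so it projects
    constantly to g k; the geodesic from q to h k therefore passes through g k. *)
Lemma branch_step g h k :
  constant_projections -> geod_line d g -> geod_line d h -> g 0 = h 0 -> 0 < k -> k <= r ->
  k + d (g k) (h k) <= d (g (2 * k)) (h k).
Proof.
  intros HT Hg Hh H0 Hk Hkr.
  set (q := g (r + k)).
  assert (Hq0 : d q (h 0) = r + k)
    by (unfold q; rewrite <- H0, dsym, (line_dist g 0); auto; lra).
  assert (E : toward d q (h 0) r = toward d q (h k) r).
  { apply HT; [exact Hh | lra |]. intros t Ht.
    pose proof (dtri q (h t) (h 0)) as T. rewrite (dsym (h t)), (line_dist h 0 t) in T; auto; lra. }
  assert (Ek : g k = toward d q (h 0) r).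
  { apply (toward_unique d H).
    - unfold q; rewrite dsym, (line_dist g k); auto; lra.
    - rewrite Hq0, <- H0, dsym, (line_dist g 0); auto; lra. }
  destruct (toward_spec d H q (h k) r) as [_ T2].
  { split; [lra|]. pose proof (dtri q (h k) (h 0)) as T.
    rewrite (dsym (h k)), (line_dist h 0 k) in T; auto; lra. }
  rewrite <- E, <- Ek in T2.
  pose proof (dtri q (g (2 * k)) (h k)) as T.
  assert (d q (g (2 * k)) = r - k)
    by (unfold q; rewrite dsym, (line_dist g (2 * k)); auto; lra).
  lra.
Qed.

(** Two geodesics that overlap in a nondegenerate segment BC form a geodesic: Stewart's inequality
    for A and the point C of BD yields e (2k + e)^2 <= e (d A D)^2. *)
Lemma local_geodesic A B C D k e :
  0 < e -> 0 <= k -> d A B = k -> d B C = e -> d C D = k ->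
  k + e <= d A C -> k + e <= d B D -> 2 * k + e <= d A D.
Proof.
  intros He Hk HAB HBC HCD HAC HBD.
  pose proof (dtri B C D). pose proof (dpos A D).
  pose proof (had_stewart H A B D C e k HBC HCD ltac:(lra)) as S.
  rewrite HAB in S.
  assert (S1 : (e + k) * (k + e)^2 <= (e + k) * d A C ^ 2).
  { apply Rmult_le_compat_l; [lra|]. apply pow_incr; lra. }
  assert (e * (2 * k + e)^2 <= e * d A D ^ 2) by nra.
  assert ((2 * k + e)^2 <= d A D ^ 2) by (apply Rmult_le_reg_l with e; lra).
  apply Rnot_lt_le; intros Hlt. nra.
Qed.

Lemma branch_double g h k :
  constant_projections -> geod_line d g -> geod_line d h -> g 0 = h 0 -> 0 < k -> k <= r ->
  g k <> h k -> 2 * k + d (g k) (h k) <= d (g (2 * k)) (h (2 * k)).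
Proof.
  intros HT Hg Hh H0 Hk Hkr Hne.
  assert (0 < d (g k) (h k)).
  { pose proof (dpos (g k) (h k)). destruct (Req_dec (d (g k) (h k)) 0) as [E|E]; [|lra].
    apply (had_eq0 H) in E. contradiction. }
  apply (local_geodesic (g (2 * k)) (g k) (h k) (h (2 * k))); auto; try lra.
  - rewrite dsym, line_dist; auto; lra.
  - rewrite line_dist; auto; lra.
  - apply branch_step; auto.
  - rewrite (dsym (g k) (h (2 * k))), (dsym (g k) (h k)).
    apply branch_step; auto.
Qed.

Lemma distinct_germs_opposite p a b :
  constant_projections -> d p a = r -> d p b = r -> ~ same_germ p a b -> 2 * r <= d a b.
Proof.
  intros HT Ha Hb Hn.
  destruct (had_line H p a) as [g [Hg [g0 g1]]]. rewrite Ha in g1.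
  destruct (had_line H p b) as [h [Hh [h0 h1]]]. rewrite Hb in h1.
  assert (Hne : forall k, 0 < k <= r -> g k <> h k).
  { intros k Hk E. apply Hn. exists k, (g k).
    split; [lra|]. split; [|split].
    - rewrite <- g0, line_dist; auto; lra.
    - rewrite <- g1, line_dist; auto; lra.
    - rewrite E, <- h1, line_dist; auto; lra. }
  (* [branch_double] at k/2 gives d (g k) (h k) >= k + d (g (k/2)) (h (k/2)); iterating sums k + k/2
     + k/4 + ... towards 2k. *)
  assert (Hind : forall n k, 0 < k <= r -> 2 * k - 2 * k / 2 ^ n <= d (g k) (h k)).
  { induction n as [|n IH]; intros k Hk.
    - simpl. pose proof (dpos (g k) (h k)). lra.
    - pose proof (branch_double g h (k / 2) HT Hg Hh ltac:(congruence) ltac:(lra) ltac:(lra)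
                    ltac:(apply Hne; lra)) as B.
      replace (2 * (k / 2)) with k in B by lra.
      specialize (IH (k / 2) ltac:(lra)).
      assert (E : 2 * k / 2 ^ S n = 2 * (k / 2) / 2 ^ n).
      { simpl. field. apply pow_nonzero; lra. }
      rewrite E. lra. }
  rewrite <- g1, <- h1. apply le_of_pow2_approx with (2 * r); [lra|].
  intros n. apply Hind; lra.
Qed.

End Branching.

(** * From equal r-spheres to equal closed r-balls *)

Section EqualSpheres.
Context {X : Type} {d d' : X -> X -> R} (H : hadamard d) (H' : hadamard d') (r : R) (Hr : 0 < r).
Context (HC : connected_at_infinity d) (HS : forall x y, d x y = r <-> d' x y = r).

Lemma spheres_le_two x y : d x y <= 2 * r -> d' x y <= 2 * r.
Proof.
  intros Hxy. destruct (common_neighbour H r x y HC Hr Hxy) as [z [Z1 Z2]].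
  apply HS in Z1. apply HS in Z2.
  pose proof (had_tri H' x z y). rewrite (had_sym H' z y) in *. lra.
Qed.

(** Prolonging the d'-geodesic beyond y by two steps of length r gives z with d x z <= 3r. The point
    h r at d-distance r from z on the d-line to x has d-distance at most 2r from x, so d' x z <= 3r,
    that is d' x y + 2r <= 3r. *)
Lemma spheres_le_one x y : d x y <= r -> d' x y <= r.
Proof.
  intros Hxy.
  destruct (had_line H' x y) as [g [Hg [g0 g1]]]. pose proof (had_pos H' x y).
  set (L := d' x y) in *.
  assert (A1 : d' y (g (L + r)) = r) by (rewrite <- g1, (line_dist g L); auto; lra).
  assert (A2 : d' (g (L + r)) (g (L + 2 * r)) = r) by (rewrite line_dist; auto; lra).
  assert (A3 : d' x (g (L + 2 * r)) = L + 2 * r) by (rewrite <- g0, (line_dist g 0); auto; lra).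
  set (z := g (L + 2 * r)) in *. apply HS in A1. apply HS in A2.
  pose proof (had_tri H y (g (L + r)) z). pose proof (had_tri H x y z).
  destruct (had_line H z x) as [h [Hh [h0 h1]]].
  rewrite (had_sym H z x) in h1. pose proof (had_pos H x z).
  assert (B1 : d z (h r) = r) by (rewrite <- h0, (line_dist h 0); auto; lra).
  assert (B2 : d x (h r) <= 2 * r).
  { rewrite <- h1, Hh. apply Rabs_le_between; lra. }
  apply HS in B1. apply spheres_le_two in B2.
  pose proof (had_tri H' x (h r) z). rewrite (had_sym H' (h r) z) in *. lra.
Qed.

Lemma spheres_le_mult n x y : d' x y = INR n * r -> d x y <= INR n * r.
Proof.
  revert x y. induction n as [|n IH]; intros x y Hxy.
  - simpl in *. assert (x = y) by (apply (had_eq0 H'); lra). subst y.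
    rewrite (had_refl H). lra.
  - rewrite S_INR in *. pose proof (pos_INR n).
    destruct (toward_spec d' H' x y r) as [T1 T2]; [nra|].
    apply HS in T1. specialize (IH (toward d' x y r) y ltac:(lra)).
    pose proof (had_tri H x (toward d' x y r) y). lra.
Qed.

Lemma projections_not_constant (p : X) : ~ constant_projections (d := d') r.
Proof.
  intros HT. destruct (had_line H' p p) as [g [Hg [g0 _]]].
  assert (A1 : d' p (g r) = r) by (rewrite <- g0, (line_dist g 0); auto; lra).
  assert (A2 : d' p (g (- r)) = r)
    by (rewrite <- g0, (had_sym H'), (line_dist g (- r)); auto; lra).
  assert (A3 : d' (g (- r)) (g r) = 2 * r) by (rewrite line_dist; auto; lra).
  assert (D1 : d p (g r) = r) by (apply HS; exact A1).
  assert (D2 : d p (g (- r)) = r) by (apply HS; exact A2).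
  destruct (outer_path (d := d) p r (g r) (g (- r))) as [c [Hc [c0 [c1 Hfar]]]]; auto; try lra.
  set (q := fun t => toward d p (c t) r).
  assert (Hq : forall t, 0 <= t <= 1 -> d' p (q t) = r).
  { intros t Ht. apply HS. apply (toward_spec d H). split; [lra | auto]. }
  assert (q0 : q 0 = g r).
  { unfold q; rewrite c0; symmetry; apply (toward_unique d H); auto.
    rewrite D1, (had_refl H); ring. }
  assert (q1 : q 1 = g (- r)).
  { unfold q; rewrite c1; symmetry; apply (toward_unique d H); auto.
    rewrite D2, (had_refl H); ring. }
  assert (Hend : same_germ (d := d') r p (g r) (q 1)).
  { apply (interval_connected (fun t => same_germ (d := d') r p (g r) (q t)) 0 1); [lra| |].
    - intros s Hs.
      destruct (toward_path H p c r Hc ltac:(lra) Hfar s Hs r Hr) as [del [Hdel Hd]].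
      exists del; split; [exact Hdel|]. intros t Ht Hts. specialize (Hd t Ht Hts).
      (* Points of the sphere that are d-close have d'-distance at most r < 2r, hence equal germs;
         so the germ is locally constant on the d-path. *)
      assert (Hst : same_germ (d := d') r p (q s) (q t)).
      { apply NNPP; intros Hn.
        apply (distinct_germs_opposite H' r Hr) in Hn; auto.
        assert (d' (q s) (q t) <= r) by (apply spheres_le_one; unfold q; lra). lra. }
      split; intros Hg'.
      + apply (same_germ_trans H' r p _ (q s)); auto.
      + apply (same_germ_trans H' r p _ (q t)); auto. apply same_germ_sym; auto.
    - rewrite q0. apply (same_germ_refl H' r Hr); auto. }
  rewrite q1 in Hend. destruct Hend as (k & z & Hk & Z1 & Z2 & Z3).
  pose proof (had_tri H' (g (- r)) z (g r)). rewrite (had_sym H' _ z) in *. lra.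
Qed.

Definition locally_bounded_at (x : X) : Prop :=
  exists e M, 0 < e /\ forall y, d' x y < e -> d x y <= M.

Lemma locally_bounded_somewhere (p : X) : exists x, locally_bounded_at x.
Proof.
  assert (Hex : exists q g L, geod_line d' g /\ 0 <= L /\
     (forall t, 0 <= t <= L -> r <= d' q (g t)) /\
     toward d' q (g 0) r <> toward d' q (g L) r).
  { apply NNPP; intros Hn. apply (projections_not_constant p).
    intros q g L Hg HL Hfar. apply NNPP; intros Hne. apply Hn.
    exists q, g, L. auto. }
  destruct Hex as (q & g & L & Hg & HL & Hfar & Hne).
  set (tau := fun t => toward d' q (g t) r).
  assert (Htau : forall t, 0 <= t <= L -> d q (tau t) = r).
  { intros t Ht. apply HS. apply (toward_spec d' H'). split; [lra | auto]. }
  set (D := d' (tau L) (tau 0)).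
  assert (HD : 0 < D).
  { pose proof (had_pos H' (tau L) (tau 0)) as HP.
    destruct (Req_dec D 0) as [E|E]; [|unfold D in *; lra].
    apply (had_eq0 H') in E. exfalso. apply Hne. symmetry. exact E. }
  set (e := Rmin (D / 2) (r / 2)).
  assert (He : 0 < e /\ e <= D / 2 /\ e <= r / 2).
  { unfold e. pose proof (Rmin_l (D / 2) (r / 2)). pose proof (Rmin_r (D / 2) (r / 2)).
    assert (0 < Rmin (D / 2) (r / 2)) by (apply Rmin_glb_lt; lra). lra. }
  (* Near q1 the d'-distance to tau 0 is below r and that to tau L at least r, so every y there has
     d'-distance exactly r, hence d-distance r, from some tau t, which has d-distance r from q. *)
  destruct (extend_beyond H' (tau L) (tau 0) (r - e)) as [q1 [Q1 Q2]]; [lra|].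
  fold D in Q2.
  assert (Hnear : forall y, d' q1 y < e -> d q y <= 2 * r).
  { intros y Hy.
    destruct (ivt (fun t => d' y (tau t)) 0 L r) as [t [Ht Heq]]; [lra| | |].
    - apply (toward_line_cont_on H'); auto; lra.
    - pose proof (had_tri H' y q1 (tau 0)). pose proof (had_tri H' (tau L) y q1).
      rewrite (had_sym H' q1 (tau 0)), (had_sym H' y q1), (had_sym H' y (tau L)) in *. lra.
    - apply HS in Heq. pose proof (had_tri H q (tau t) y).
      rewrite (had_sym H y) in Heq. rewrite Htau in * by exact Ht. lra. }
  exists q1, e, (4 * r). split; [lra|]. intros y Hy.
  pose proof (Hnear y Hy). assert (d q q1 <= 2 * r) by (apply Hnear; rewrite (had_refl H'); lra).
  pose proof (had_tri H q1 q y). rewrite (had_sym H q1 q) in *. lra.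
Qed.

(** For y' near y, the d'-line from y' to z contains a point at d'-distance exactly r from y', and
    it misses z by at most d' y y'. *)
Lemma locally_bounded_step y z : d y z = r -> locally_bounded_at z -> locally_bounded_at y.
Proof.
  intros Hyz (e & M & He & HM). exists e, (2 * r + M). split; [exact He|].
  intros y' Hy'.
  destruct (had_line H' y' z) as [g [Hg [g0 g1]]].
  assert (D1 : d' y' (g r) = r) by (rewrite <- g0 at 1; rewrite line_dist; auto; lra).
  assert (D2 : d' z (g r) <= d' y y').
  { rewrite <- g1 at 1. rewrite Hg. apply HS in Hyz.
    pose proof (dist_rev_tri d' H' z y y') as T. rewrite (had_sym H' z), Hyz in T.
    rewrite (had_sym H' z y') in T. rewrite <- Rabs_Ropp. 
    replace (- (d' y' z - r)) with (r - d' y' z) by ring. exact T. }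
  apply HS in D1. specialize (HM (g r) ltac:(lra)).
  pose proof (had_tri H y z y'). pose proof (had_tri H z (g r) y').
  rewrite (had_sym H (g r) y') in *. lra.
Qed.

Lemma locally_bounded_everywhere (x : X) : locally_bounded_at x.
Proof.
  destruct (locally_bounded_somewhere x) as [z Hz].
  assert (Hn : forall n z, locally_bounded_at z -> d z x <= INR n * r -> locally_bounded_at x).
  { clear z Hz. induction n as [|n IH]; intros z Hz Hzx.
    - simpl in Hzx. pose proof (had_pos H z x).
      assert (z = x) by (apply (had_eq0 H); lra). subst z; exact Hz.
    (* Steps must have length exactly r; a remaining distance of at most 2r is covered by two of
       them through a common neighbour. *)
    - rewrite S_INR in Hzx. destruct (Rle_dec (d z x) (2 * r)) as [L|L].
      + destruct (common_neighbour H r z x HC Hr L) as [w [W1 W2]].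
        apply (locally_bounded_step x w W2). apply (locally_bounded_step w z); auto.
        rewrite (had_sym H); auto.
      + destruct (toward_spec d H z x r) as [T1 T2]; [lra|].
        apply (IH (toward d z x r)); [|lra].
        apply (locally_bounded_step _ z); auto. rewrite (had_sym H); auto. }
  destruct (nat_above (d z x / r)) as [n Hnn].
  apply (Hn n z Hz). apply Rmult_lt_compat_r with (r := r) in Hnn; [|lra].
  replace (d z x / r * r) with (d z x) in Hnn by (field; lra). lra.
Qed.

(** Boundedness on [0, t] is a locally constant property of t, which replaces a covering
    argument. *)
Lemma bounded_on_segment g R0 :
  geod_line d' g -> 0 <= R0 -> exists M, forall s, 0 <= s <= R0 -> d (g 0) (g s) <= M.
Proof.
  intros Hg HR.
  apply (interval_connected (fun t => exists M, forall s, 0 <= s <= t -> d (g 0) (g s) <= M) 0 R0);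
    [exact HR| |].
  - intros s0 Hs0. destruct (locally_bounded_everywhere (g s0)) as (e & M0 & He & HM0).
    assert (HM0' : forall s, Rabs (s - s0) < e -> d (g s0) (g s) <= M0).
    { intros s Hs. apply HM0. rewrite Hg, <- Rabs_Ropp.
      replace (- (s0 - s)) with (s - s0) by ring. exact Hs. }
    exists e; split; [exact He|]. intros t Ht Hts. apply Rabs_lt_between in Hts.
    split; intros [M HM]; exists (Rmax M (d (g 0) (g s0) + M0)); intros s Hs;
      pose proof (Rmax_l M (d (g 0) (g s0) + M0)); pose proof (Rmax_r M (d (g 0) (g s0) + M0));
      pose proof (had_tri H (g 0) (g s0) (g s)).
    + destruct (Rle_dec s s0); [specialize (HM s); lra|].
      specialize (HM0' s ltac:(apply Rabs_lt_between; lra)). lra.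
    + destruct (Rle_dec s t); [specialize (HM s); lra|].
      specialize (HM0' s ltac:(apply Rabs_lt_between; lra)). lra.
  - exists 0. intros s Hs. replace s with 0 by lra. rewrite (had_refl H). lra.
Qed.

(* Every point of the d'-ball is at d'-distance exactly N r from some point of a fixed
   d'-segment, hence at d-distance at most N r from it. *)
Lemma bounded_on_balls x R0 : exists M, forall y, d' x y <= R0 -> d x y <= M.
Proof.
  destruct (had_line H' x x) as [g [Hg [g0 _]]].
  destruct (nat_above (Rabs R0 / r)) as [N HN].
  apply Rmult_lt_compat_r with (r := r) in HN; [|lra].
  replace (Rabs R0 / r * r) with (Rabs R0) in HN by (field; lra).
  pose proof (Rle_abs R0). pose proof (Rabs_pos R0).
  destruct (bounded_on_segment g (2 * (INR N * r)) Hg) as [M HM]; [lra|].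
  exists (M + INR N * r). intros y Hy.
  destruct (ivt (fun s => d' y (g s)) 0 (2 * (INR N * r)) (INR N * r)) as [s [Hs Heq]];
    [lra| | |].
  - apply (dist_line_cont_on H'); exact Hg.
  - rewrite g0, (had_sym H' y x). split; [lra|].
    pose proof (had_tri H' x y (g (2 * (INR N * r)))) as T.
    rewrite <- g0 in T at 1. rewrite line_dist in T; auto; lra.
  - apply spheres_le_mult in Heq. specialize (HM s Hs). rewrite g0 in HM.
    pose proof (had_tri H x (g s) y). rewrite (had_sym H (g s) y) in *. lra.
Qed.

(* Otherwise the d'-sphere of radius r about x splits into the points d'-closer to y than r
   and the others, and so does the complement of the d'-ball; a d-path far from x, whose
   small steps are d'-short, cannot pass from one part to the other. *)
Lemma common_neighbour_transfer x y :
  d' x y <= 2 * r -> exists z, d' x z = r /\ d' y z = r.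
Proof.
  intros Hxy. apply NNPP; intros Hn.
  assert (Hne : forall z, d' x z = r -> d' y z <> r) by (intros z Hz E; apply Hn; eauto).
  destruct (bounded_on_balls x (3 * r)) as [M HM].
  (* A d-path at d-distance at least m r > M from x avoids the d'-ball of radius 3r, and points at
     d'-distance above m r have d-distance at least m r, so the path may start and end at g T and g
     (- T). *)
  destruct (nat_above (Rmax M (3 * r) / r)) as [m Hm].
  apply Rmult_lt_compat_r with (r := r) in Hm; [|lra].
  replace (Rmax M (3 * r) / r * r) with (Rmax M (3 * r)) in Hm by (field; lra).
  pose proof (Rmax_l M (3 * r)). pose proof (Rmax_r M (3 * r)).
  destruct (had_line H' x y) as [g [Hg [g0 g1]]]. pose proof (had_pos H' x y) as Hp.
  set (L := d' x y) in *. set (T := (INR m + 1) * r).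
  assert (HT : INR m * r < T) by (unfold T; lra).
  assert (W : forall w, INR m * r < d' x w -> INR m * r <= d x w).
  { intros w Hw. apply Rnot_lt_le; intros Hlt.
    pose proof (near_chain r Hr d d' H H' spheres_le_one m x w). lra. }
  assert (E1 : d' x (g T) = T) by (rewrite <- g0, (line_dist g 0); auto; lra).
  assert (E2 : d' x (g (- T)) = T)
    by (rewrite <- g0, (had_sym H'), (line_dist g (- T)); auto; lra).
  destruct (outer_path (d := d) x (INR m * r) (g T) (g (- T))) as [c [Hc [c0 [c1 Hfar]]]]; auto.
  { lra. }
  { apply W; lra. }
  { apply W; lra. }
  assert (Hfar' : forall t, 0 <= t <= 1 -> 3 * r < d' x (c t)).
  { intros t Ht. apply Rnot_le_lt; intros Hle. specialize (HM _ Hle). specialize (Hfar t Ht). lra. }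
  assert (F1 : toward d' x (g T) r = g r).
  { symmetry; apply (toward_unique d' H').
    - rewrite <- g0, (line_dist g 0); auto; lra.
    - rewrite E1, line_dist; auto; lra. }
  assert (F2 : toward d' x (g (- T)) r = g (- r)).
  { symmetry; apply (toward_unique d' H').
    - rewrite <- g0, (had_sym H'), (line_dist g (- r)); auto; lra.
    - rewrite E2, (had_sym H'), line_dist; auto; lra. }
  assert (Hend : d' y (toward d' x (c 1) r) < r).
  { apply (interval_connected (fun t => d' y (toward d' x (c t) r) < r) 0 1); [lra| |].
    - intros s Hs. destruct (Hc s Hs r Hr) as [del [Hdel Hd]].
      exists del; split; [exact Hdel|]. intros t Ht Hts.
      (* The d'-geodesic from u to v stays outside the r-ball, so its projection is a d'-continuous
         curve on the sphere, on which the distance to y never equals r. *)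
      assert (Hstep : forall u v, 3 * r < d' x u -> d' u v <= r ->
                d' y (toward d' x u r) < r -> d' y (toward d' x v r) < r).
      { intros u v Hu Huv Hlt. destruct (had_line H' u v) as [h [Hh [h0 h1]]].
        rewrite <- h1. rewrite <- h0 in Hlt. pose proof (had_pos H' u v) as Hpuv.
        assert (Hout : forall a, 0 <= a <= d' u v -> r <= d' x (h a)).
        { intros a Ha. pose proof (had_tri H' x (h a) u) as T1. rewrite <- h0 in T1 at 2.
          rewrite (had_sym H' (h a)), (line_dist h 0 a) in T1; auto; lra. }
        apply (ivt_avoid (fun a => d' y (toward d' x (h a) r)) 0 (d' u v)); auto.
        - apply (toward_line_cont_on H'); auto; lra.
        - intros a Ha. apply Hne. apply (toward_spec d' H'). split; [lra | auto]. }
      assert (d' (c s) (c t) <= r) by (apply spheres_le_one; specialize (Hd t Ht Hts); lra).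
      split; apply Hstep; auto. rewrite (had_sym H'); auto.
    (* The start g r has distance |L - r| from y; the values L = 2r and L = 0 are excluded since g r
       would be a common neighbour. At the end g (- r) the distance is L + r. *)
    - rewrite c0, F1, <- g1, Hg.
      assert (L - r <> r).
      { intros E. apply (Hne (g r)).
        - rewrite <- g0, (line_dist g 0); auto; lra.
        - rewrite <- g1, (had_sym H'), line_dist; auto; lra. }
      assert (L - r <> - r).
      { intros E. apply (Hne (g r)).
        - rewrite <- g0, (line_dist g 0); auto; lra.
        - rewrite <- g1. replace L with 0 by lra. rewrite line_dist; auto; lra. }
      apply Rabs_lt_between. lra. }
  rewrite c1, F2, <- g1, (had_sym H'), line_dist in Hend; auto; lra.
Qed.

Lemma equal_balls_of_equal_spheres x y : d x y <= r <-> d' x y <= r.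
Proof.
  split; [apply spheres_le_one|]. intros Hxy.
  assert (Htwo : forall u v, d' u v <= 2 * r -> d u v <= 2 * r).
  { intros u v Huv. destruct (common_neighbour_transfer u v Huv) as [z [Z1 Z2]].
    apply HS in Z1. apply HS in Z2.
    pose proof (had_tri H u z v). rewrite (had_sym H z v) in *. lra. }
  (* From here the argument of [spheres_le_one] is repeated with the metrics exchanged. *)
  destruct (extend_beyond H x y (2 * r)) as [z [Z1 Z2]]; [lra|].
  assert (B : d' y z <= 2 * r) by (apply spheres_le_two; lra).
  destruct (had_line H' z x) as [h [Hh [h0 h1]]].
  rewrite (had_sym H' z x) in h1. pose proof (had_pos H' x z). pose proof (had_tri H' x y z).
  assert (B1 : d' z (h r) = r) by (rewrite <- h0, (line_dist h 0); auto; lra).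
  assert (B2 : d' x (h r) <= 2 * r).
  { rewrite <- h1, Hh. apply Rabs_le_between; lra. }
  apply HS in B1. apply Htwo in B2.
  pose proof (had_tri H x (h r) z). rewrite (had_sym H (h r) z) in *. lra.
Qed.

End EqualSpheres.

(** * Busemann functions *)

Section Busemann.
Context {X : Type}.

(** A geodesic ray recorded only at the parameters n r, where distances are multiples of r and can
    be read off in both metrics. *)
Definition nat_ray (d : X -> X -> R) (r : R) (a : nat -> X) : Prop :=
  forall i j, d (a i) (a j) = Rabs (INR i - INR j) * r.

Definition samples (r : R) (g : R -> X) (n : nat) : X := g (INR n * r).

(** Along a ray d x (a n) - n r does not increase with n, so its infimum l is the limit that defines
    the Busemann function. *)
Definition is_busemann (d : X -> X -> R) (r : R) (a : nat -> X) (x : X) (l : R) : Prop :=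
  (forall n, l <= d x (a n) - INR n * r) /\
  forall e, 0 < e -> exists n, d x (a n) - INR n * r < l + e.

Definition busemann (d : X -> X -> R) (r : R) (a : nat -> X) (x : X) : R :=
  epsilon (inhabits 0) (is_busemann d r a x).

Context {d : X -> X -> R} (H : hadamard d) {r : R} (Hr : 0 < r).

Local Notation dpos := (had_pos H).
Local Notation dsym := (had_sym H).
Local Notation dtri := (had_tri H).

Lemma nat_ray_le a i j : nat_ray d r a -> (i <= j)%nat -> d (a i) (a j) = (INR j - INR i) * r.
Proof.
  intros Ha Hij. rewrite Ha. apply le_INR in Hij. rewrite Rabs_left1; lra.
Qed.

Lemma busemann_spec a x : nat_ray d r a -> is_busemann d r a x (busemann d r a x).
Proof.
  intros Ha. unfold busemann. apply epsilon_spec.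
  set (E := fun y => exists n, y = - (d x (a n) - INR n * r)).
  destruct (completeness E) as [l [Hub Hlub]].
  - exists (d x (a 0%nat)). intros y [n ->].
    pose proof (dtri (a 0%nat) x (a n)). rewrite (nat_ray_le a 0 n Ha) in * by lia.
    rewrite (dsym (a 0%nat) x) in *. simpl in *. lra.
  - exists (- (d x (a 0%nat) - INR 0 * r)), 0%nat. reflexivity.
  - exists (- l). split.
    + intros n. assert (- (d x (a n) - INR n * r) <= l) by (apply Hub; exists n; reflexivity). lra.
    + intros e He. apply NNPP; intros Hn. assert (l <= l - e); [|lra].
      apply Hlub. intros y [n ->]. apply Rnot_lt_le; intros Hlt. apply Hn. exists n. lra.
Qed.

Lemma busemann_le a x n : nat_ray d r a -> busemann d r a x <= d x (a n) - INR n * r.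
Proof. intros Ha. apply (busemann_spec a x Ha). Qed.

Lemma busemann_decr a x i j : nat_ray d r a -> (i <= j)%nat ->
  d x (a j) - INR j * r <= d x (a i) - INR i * r.
Proof.
  intros Ha Hij. pose proof (dtri x (a i) (a j)). rewrite (nat_ray_le a i j) in *; auto. lra.
Qed.

Lemma busemann_approx a x e : nat_ray d r a -> 0 < e ->
  exists N, forall n, (N <= n)%nat -> d x (a n) - INR n * r < busemann d r a x + e.
Proof.
  intros Ha He. destruct (proj2 (busemann_spec a x Ha) e He) as [N HN].
  exists N. intros n Hn. pose proof (busemann_decr a x N n Ha Hn). lra.
Qed.

Lemma busemann_unique a x l : nat_ray d r a -> is_busemann d r a x l -> busemann d r a x = l.
Proof.
  intros Ha [Hl1 Hl2]. destruct (busemann_spec a x Ha) as [B1 B2].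
  apply Rle_antisym; apply Rnot_lt_le; intros Hlt.
  - destruct (Hl2 (busemann d r a x - l)) as [n Hn]; [lra|]. specialize (B1 n). lra.
  - destruct (B2 (l - busemann d r a x)) as [n Hn]; [lra|]. specialize (Hl1 n). lra.
Qed.

Lemma busemann_lipschitz a x y : nat_ray d r a ->
  busemann d r a x - busemann d r a y <= d x y.
Proof.
  intros Ha. apply Rnot_lt_le; intros Hlt.
  destruct (proj2 (busemann_spec a y Ha) (busemann d r a x - busemann d r a y - d x y)) as [n Hn];
    [lra|].
  pose proof (busemann_le a x n Ha). pose proof (dtri x y (a n)). lra.
Qed.

Lemma busemann_on_ray a n : nat_ray d r a -> busemann d r a (a n) = - (INR n * r).
Proof.
  intros Ha. apply busemann_unique; [exact Ha|]. split.
  - intros m. rewrite Ha. pose proof (Rle_abs (INR m - INR n)).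
    rewrite <- (Rabs_Ropp (INR n - INR m)).
    replace (- (INR n - INR m)) with (INR m - INR n) by ring. nra.
  - intros e He. exists n. rewrite (had_refl H). lra.
Qed.

Lemma busemann_convex a : nat_ray d r a -> geod_convex d (busemann d r a).
Proof.
  intros Ha p q z s t H1 H2 H3.
  pose proof (dpos p z) as Hs. pose proof (dpos z q) as Ht. rewrite H1 in Hs. rewrite H2 in Ht.
  apply Rnot_lt_le; intros Hlt.
  set (b := busemann d r a) in *.
  set (gap := (s + t) * b z - (t * b p + s * b q)) in *.
  assert (Hst : 0 < s + t).
  { destruct (Req_dec (s + t) 0) as [E|E]; [|lra].
    exfalso. replace s with 0 in Hlt by lra. replace t with 0 in Hlt by lra. lra. }
  (* The approximation errors at p and q have total weight s + t and use up half of the gap. *)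
  set (e := gap / (2 * (s + t))).
  assert (He : e * (2 * (s + t)) = gap) by (unfold e; field; lra).
  assert (He0 : 0 < e) by (apply Rmult_lt_reg_r with (2 * (s + t)); unfold gap in *; lra).
  destruct (busemann_approx a p e Ha He0) as [N1 HN1].
  destruct (busemann_approx a q e Ha He0) as [N2 HN2].
  set (n := Nat.max N1 N2).
  specialize (HN1 n (Nat.le_max_l _ _)). specialize (HN2 n (Nat.le_max_r _ _)).
  pose proof (busemann_le a z n Ha) as Bz. fold b in Bz, HN1, HN2.
  pose proof (dist_geod_convex d H (a n) p q z s t H1 H2 H3) as HC.
  rewrite !(dsym (a n)) in HC. unfold gap in *.
  assert ((s + t) * b z <= (s + t) * (d z (a n) - INR n * r)) by (apply Rmult_le_compat_l; lra).
  assert (t * d p (a n) <= t * (b p + e + INR n * r)) by (apply Rmult_le_compat_l; lra).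
  assert (s * d q (a n) <= s * (b q + e + INR n * r)) by (apply Rmult_le_compat_l; lra).
  nra.
Qed.

Lemma samples_ray g : geod_line d g -> nat_ray d r (samples r g).
Proof.
  intros Hg i j. unfold samples. rewrite Hg.
  replace (INR i * r - INR j * r) with ((INR i - INR j) * r) by ring.
  rewrite Rabs_mult, (Rabs_right r); lra.
Qed.

Lemma busemann_on_line g s : geod_line d g -> busemann d r (samples r g) (g s) = - s.
Proof.
  intros Hg. apply busemann_unique; [apply samples_ray; exact Hg|]. unfold samples. split.
  - intros n. rewrite Hg. pose proof (Rle_abs (INR n * r - s)).
    rewrite <- (Rabs_Ropp (s - INR n * r)). 
    replace (- (s - INR n * r)) with (INR n * r - s) by ring. lra.
  - intros e He. destruct (nat_above (s / r)) as [n Hn].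
    apply Rmult_lt_compat_r with (r := r) in Hn; [|lra].
    replace (s / r * r) with s in Hn by (field; lra).
    exists n. rewrite Hg, Rabs_left; lra.
Qed.

(* The quadrilateral inequality with vertices x, y and far points of the two rays,
   divided by the distance to the latter. *)
Lemma busemann_diff_le a c M x y :
  nat_ray d r a -> nat_ray d r c -> (forall n, d (a n) (c n) <= M) ->
  busemann d r c x - busemann d r a x <= busemann d r c y - busemann d r a y.
Proof.
  intros Ha Hc HM. apply Rnot_lt_le; intros Hlt.
  set (bax := busemann d r a x) in *. set (bay := busemann d r a y) in *.
  set (bcx := busemann d r c x) in *. set (bcy := busemann d r c y) in *.
  set (gap := (bcx - bax) - (bcy - bay)) in *. assert (Hgap : 0 < gap) by (unfold gap; lra).
  set (e := gap / 4). assert (He : 0 < e) by (unfold e; lra).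
  destruct (busemann_approx a x e Ha He) as [N1 HN1].
  destruct (busemann_approx c y e Hc He) as [N2 HN2].
  set (B := Rabs bax + Rabs bay + Rabs bcx + Rabs bcy + e).
  (* K collects all terms bounded independently of n, while the gap contributes at least n r times
     [gap]. *)
  set (K := (d x y)^2 + M^2 + 2 * B^2).
  destruct (nat_above (K / (gap * r))) as [N3 HN3].
  apply Rmult_lt_compat_r with (r := gap * r) in HN3; [|nra].
  replace (K / (gap * r) * (gap * r)) with K in HN3 by (field; lra).
  set (n := Nat.max N1 (Nat.max N2 N3)).
  specialize (HN1 n ltac:(lia)). specialize (HN2 n ltac:(lia)).
  assert (HN3' : K < INR n * (gap * r)).
  { eapply Rlt_le_trans; [exact HN3|]. apply Rmult_le_compat_r; [nra|].
    apply le_INR; lia. }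
  pose proof (busemann_le c x n Hc) as L1. pose proof (busemann_le a y n Ha) as L2.
  fold bax bcy bcx bay in HN1, HN2, L1, L2.
  pose proof (busemann_le a x n Ha) as L3. pose proof (busemann_le c y n Hc) as L4.
  fold bax bcy in L3, L4.
  pose proof (quadrilateral d H x (c n) y (a n)) as Q.
  rewrite (dsym (c n) (a n)), (dsym (a n) x) in Q.
  assert (HM' : d (a n) (c n) ^ 2 <= M ^ 2) by (apply pow_incr; split; [apply dpos|apply HM]).
  set (t := INR n * r) in *.
  assert (Ht : 0 <= t) by (unfold t; pose proof (pos_INR n); nra).
  set (Dxc := d x (c n)) in *. set (Dya := d y (a n)) in *.
  set (Dxa := d x (a n)) in *. set (Dyc := d y (c n)) in *.
  assert (P1 : Dxa ^ 2 <= t ^ 2 + 2 * t * (bax + e) + B ^ 2).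
  { assert (HB : Rabs (Dxa - t) <= B).
    { apply Rabs_le_between. unfold B.
      pose proof (Rle_abs bax). pose proof (Rle_abs (- bax)). rewrite Rabs_Ropp in *.
      pose proof (Rabs_pos bay). pose proof (Rabs_pos bcx). pose proof (Rabs_pos bcy). lra. }
    assert ((Dxa - t) ^ 2 <= B ^ 2) by (rewrite <- (pow2_abs (Dxa - t)); apply pow_incr; split; [apply Rabs_pos|exact HB]).
    nra. }
  assert (P2 : Dyc ^ 2 <= t ^ 2 + 2 * t * (bcy + e) + B ^ 2).
  { assert (HB : Rabs (Dyc - t) <= B).
    { apply Rabs_le_between. unfold B.
      pose proof (Rle_abs bcy). pose proof (Rle_abs (- bcy)). rewrite Rabs_Ropp in *.
      pose proof (Rabs_pos bay). pose proof (Rabs_pos bcx). pose proof (Rabs_pos bax). lra. }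
    assert ((Dyc - t) ^ 2 <= B ^ 2) by (rewrite <- (pow2_abs (Dyc - t)); apply pow_incr; split; [apply Rabs_pos|exact HB]).
    nra. }
  assert (P3 : t ^ 2 + 2 * t * bcx <= Dxc ^ 2).
  { pose proof (pow2_ge_0 (Dxc - t)). nra. }
  assert (P4 : t ^ 2 + 2 * t * bay <= Dya ^ 2).
  { pose proof (pow2_ge_0 (Dya - t)). nra. }
  assert (E : 2 * t * (bcx + bay - bax - bcy - 2 * e) = t * gap) by (unfold e, gap; field).
  replace (INR n * (gap * r)) with (t * gap) in HN3' by (unfold t; ring).
  unfold K in HN3'. nra.
Qed.

Lemma busemann_diff a c M x y :
  nat_ray d r a -> nat_ray d r c -> (forall n, d (a n) (c n) <= M) ->
  busemann d r c x - busemann d r a x = busemann d r c y - busemann d r a y.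
Proof.
  intros Ha Hc HM. apply Rle_antisym; apply busemann_diff_le with M; auto.
Qed.

Lemma busemann_tail a m x : nat_ray d r a ->
  busemann d r (fun n => a (n + m)%nat) x = busemann d r a x + INR m * r.
Proof.
  intros Ha. apply busemann_unique.
  - intros i j. rewrite Ha, !plus_INR. f_equal. f_equal. ring.
  - split.
    + intros n. pose proof (busemann_le a x (n + m) Ha) as L. rewrite plus_INR in L. lra.
    + intros e He. destruct (busemann_approx a x e Ha He) as [N HN].
      exists N. specialize (HN (N + m)%nat ltac:(lia)). rewrite plus_INR in HN. lra.
Qed.

(* Stewart's inequality in the triangle x, a 0, a n at the point a j, as n tends to infinity. *)
Lemma strip_bound a x j : nat_ray d r a ->
  (d x (a j))^2 <= (INR j * r)^2 + 2 * (INR j * r) * busemann d r a x + (d x (a 0%nat))^2.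
Proof.
  intros Ha. set (G := busemann d r a x). set (h := d x (a 0%nat)). set (s := INR j * r).
  assert (Hs : 0 <= s) by (unfold s; pose proof (pos_INR j); nra).
  apply Rnot_lt_le; intros Hlt.
  set (gap := (d x (a j))^2 - (s ^ 2 + 2 * s * G + h ^ 2)) in *.
  assert (Hgap : 0 < gap) by (unfold gap; lra).
  set (e := gap / (4 * (s + 1))).
  assert (Ee : e * (4 * (s + 1)) = gap) by (unfold e; field; lra).
  assert (He : 0 < e) by (apply Rmult_lt_reg_r with (4 * (s + 1)); lra).
  destruct (busemann_approx a x e Ha He) as [N HN].
  set (K := (Rabs G + e) ^ 2).
  destruct (nat_above (2 * s * K / (gap * r))) as [N3 HN3].
  apply Rmult_lt_compat_r with (r := gap * r) in HN3; [|nra].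
  replace (2 * s * K / (gap * r) * (gap * r)) with (2 * s * K) in HN3 by (field; lra).
  set (n := (N + N3 + j + 1)%nat).
  specialize (HN n ltac:(lia)). pose proof (busemann_le a x n Ha) as L. fold G in HN, L.
  assert (HN3' : 2 * s * K < INR n * r * gap).
  { eapply Rlt_le_trans; [exact HN3|]. rewrite Rmult_assoc, (Rmult_comm r gap).
    apply Rmult_le_compat_r; [nra|]. apply le_INR; lia. }
  assert (J1 : d (a 0%nat) (a j) = s) by (rewrite (nat_ray_le a 0 j Ha) by lia; simpl; unfold s; ring).
  assert (J2 : d (a j) (a n) = INR n * r - s) by (rewrite (nat_ray_le a j n Ha) by lia; unfold s; ring).
  assert (J3 : d (a 0%nat) (a n) = s + (INR n * r - s)) by (rewrite (nat_ray_le a 0 n Ha) by lia; simpl; ring).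
  pose proof (had_stewart H x _ _ _ _ _ J1 J2 J3) as S. fold h in S.
  set (T := INR n * r) in *.
  assert (HT : 0 < T) by (unfold T; apply Rmult_lt_0_compat; [apply lt_0_INR; lia|lra]).
  assert (HTs : s <= T).
  { unfold s, T. apply Rmult_le_compat_r; [lra|]. apply le_INR; lia. }
  assert (HB : (d x (a n) - T)^2 <= K).
  { unfold K. rewrite <- (pow2_abs (d x (a n) - T)). apply pow_incr. split; [apply Rabs_pos|].
    apply Rabs_le_between.
    pose proof (Rle_abs G). pose proof (Rle_abs (- G)). rewrite Rabs_Ropp in *. lra. }
  assert (HD : (d x (a n))^2 <= T ^ 2 + 2 * T * (G + e) + K) by nra.
  assert (HD' : s * (d x (a n))^2 <= s * (T ^ 2 + 2 * T * (G + e) + K))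
    by (apply Rmult_le_compat_l; lra).
  replace (s + (T - s)) with T in S by ring.
  assert (F : T * (d x (a j))^2 <= T * (s ^ 2 + 2 * s * G + h ^ 2 + 2 * s * e) + s * K).
  { assert (0 <= s * h ^ 2) by (pose proof (pow2_ge_0 h); nra). nra. }
  assert (F2 : 2 * s * e <= gap / 2) by nra.
  assert (T * gap <= T * (gap / 2) + s * K).
  { unfold gap at 1. nra. }
  nra.
Qed.

(* In a flat strip the ray from x towards the end of [a] is parallel to [a]; a 1-Lipschitz
   function that drops by almost j r along both rays drops by the Busemann function across. *)
Lemma strip_increment (h : X -> R) a x M k j :
  nat_ray d r a -> (forall y z, h y - h z <= d y z) -> d x (a 0%nat) <= M -> (1 <= j)%nat ->
  INR j * r - k <= h (a 0%nat) - h (a j) ->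
  h x - h (a 0%nat) <= busemann d r a x + M ^ 2 / (2 * (INR j * r)) + k.
Proof.
  intros Ha Hh HM Hj Hk.
  assert (Hs : 0 < INR j * r) by (apply Rmult_lt_0_compat; [apply lt_0_INR; lia|lra]).
  pose proof (strip_bound a x j Ha) as S. pose proof (Hh x (a j)) as L.
  set (s := INR j * r) in *. set (G := busemann d r a x) in *.
  assert (HM2 : d x (a 0%nat) ^ 2 <= M ^ 2) by (apply pow_incr; split; [apply dpos | exact HM]).
  assert (D : d x (a j) <= s + G + M ^ 2 / (2 * s)).
  { apply Rmult_le_reg_l with (2 * s); [lra|].
    replace (2 * s * (s + G + M ^ 2 / (2 * s))) with (2 * s ^ 2 + 2 * s * G + M ^ 2) by (field; lra).
    pose proof (pow2_ge_0 (d x (a j) - s)). nra. }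
  lra.
Qed.

(** The Busemann functions of a and c differ by a constant, so that of c at a 0 is minus that of a
    at c 0; [strip_increment] in both directions gives the two bounds. *)
Lemma strip_increment_abs (h : X -> R) a c M k j :
  nat_ray d r a -> nat_ray d r c -> (forall n, d (a n) (c n) <= M) ->
  (forall y z, h y - h z <= d y z) -> (1 <= j)%nat ->
  INR j * r - k <= h (a 0%nat) - h (a j) -> INR j * r - k <= h (c 0%nat) - h (c j) ->
  Rabs (h (c 0%nat) - h (a 0%nat) - busemann d r a (c 0%nat)) <= M ^ 2 / (2 * (INR j * r)) + k.
Proof.
  intros Ha Hc HM Hh Hj Ka Kc.
  pose proof (HM 0%nat) as H0.
  pose proof (strip_increment h a (c 0%nat) M k j Ha Hh ltac:(rewrite dsym; exact H0) Hj Ka) as S1.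
  pose proof (strip_increment h c (a 0%nat) M k j Hc Hh H0 Hj Kc) as S2.
  pose proof (busemann_diff a c M (a 0%nat) (c 0%nat) Ha Hc HM) as E.
  rewrite (busemann_on_ray a 0 Ha), (busemann_on_ray c 0 Hc) in E. simpl in E.
  apply Rabs_le_between. lra.
Qed.

End Busemann.

(** * Two metrics with the same balls *)

(** The point at parameter s is taken on the geodesic from a 0 to any a m with m r >= s; uniqueness
    of geodesics makes the choice of m irrelevant. *)
Lemma half_line_of_ray {X : Type} {d : X -> X -> R} (H : hadamard d) (r : R) (a : nat -> X) :
  0 < r -> nat_ray d r a ->
  exists g : R -> X, (forall s t, 0 <= s -> s <= t -> d (g s) (g t) = t - s) /\
    forall n, g (INR n * r) = a n.
Proof.
  intros Hr Ha.
  set (m := fun s => epsilon (inhabits 0%nat) (fun n => s <= INR n * r)).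
  assert (Hm : forall s, s <= INR (m s) * r).
  { intros s. unfold m. apply epsilon_spec. destruct (nat_above (s / r)) as [n Hn].
    exists n. apply Rmult_lt_compat_r with (r := r) in Hn; [|lra].
    replace (s / r * r) with s in Hn by (field; lra). lra. }
  set (g := fun s => toward d (a 0%nat) (a (m s)) s).
  assert (Hg : forall s M, 0 <= s -> (m s <= M)%nat ->
            d (a 0%nat) (g s) = s /\ d (g s) (a M) = INR M * r - s).
  { intros s M Hs HM. pose proof (nat_ray_le a 0 (m s) Ha ltac:(lia)) as D0. simpl in D0.
    specialize (Hm s).
    destruct (toward_spec d H (a 0%nat) (a (m s)) s) as [T1 T2]; [lra|]. fold (g s) in T1, T2.
    split; [exact T1|].
    pose proof (had_tri H (g s) (a (m s)) (a M)) as U.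
    rewrite (nat_ray_le (d := d) (r := r) a (m s) M Ha HM) in U.
    pose proof (had_tri H (a 0%nat) (g s) (a M)) as V.
    rewrite (nat_ray_le (d := d) (r := r) a 0 M Ha) in V by lia. simpl in V. lra. }
  exists g. split.
  - intros s t Hs Hst. set (M := Nat.max (m s) (m t)).
    destruct (Hg s M Hs ltac:(lia)) as [S1 S2].
    destruct (Hg t M ltac:(lra) ltac:(lia)) as [T1 T2].
    destruct (toward_spec d H (a 0%nat) (g t) s) as [W1 W2]; [lra|].
    set (w := toward d (a 0%nat) (g t) s) in *.
    pose proof (had_tri H w (g t) (a M)). pose proof (had_tri H (a 0%nat) w (a M)).
    assert (D0 : d (a 0%nat) (a M) = INR M * r)
      by (rewrite (nat_ray_le (d := d) (r := r) a 0 M Ha) by lia; simpl; ring).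
    rewrite (between_unique d H (a 0%nat) (a M) (g s) w s (INR M * r - s)); lra.
  - intros n. assert (Hn : 0 <= INR n * r) by (pose proof (pos_INR n); nra).
    set (M := Nat.max (m (INR n * r)) n).
    destruct (Hg (INR n * r) M Hn ltac:(lia)) as [S1 S2].
    assert (D0 : d (a 0%nat) (a M) = INR M * r)
      by (rewrite (nat_ray_le (d := d) (r := r) a 0 M Ha) by lia; simpl; ring).
    apply (between_unique d H (a 0%nat) (a M) _ _ (INR n * r) (INR M * r - INR n * r)); auto; try lra.
    + rewrite (nat_ray_le (d := d) (r := r) a 0 n Ha) by lia; simpl; ring.
    + rewrite (nat_ray_le (d := d) (r := r) a n M Ha) by lia; simpl; ring.
Qed.

Definition same_balls {X : Type} (r : R) (d d' : X -> X -> R) : Prop :=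
  forall n x y, (d x y <= INR n * r <-> d' x y <= INR n * r) /\
                (d x y < INR n * r <-> d' x y < INR n * r).

Lemma same_balls_sym {X : Type} r (d d' : X -> X -> R) : same_balls r d d' -> same_balls r d' d.
Proof. intros HA n x y. destruct (HA n x y) as [[A1 A2] [B1 B2]]. repeat split; auto. Qed.

(** * Rays and the order of Busemann values carry over to the other metric *)

Section Transfer.
Context {X : Type} {d d' : X -> X -> R} (H : hadamard d) (H' : hadamard d').
Context {r : R} (Hr : 0 < r) (HA : same_balls r d d').

Lemma nat_ray_transfer a : nat_ray d r a -> nat_ray d' r a.
Proof.
  assert (Haux : nat_ray d r a -> forall i j, (i <= j)%nat -> d' (a i) (a j) = (INR j - INR i) * r).
  { intros Ha i j Hij. rewrite <- minus_INR by exact Hij.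
    assert (E : d (a i) (a j) = INR (j - i) * r).
    { rewrite (nat_ray_le a i j Ha Hij), minus_INR by exact Hij. reflexivity. }
    destruct (HA (j - i)%nat (a i) (a j)) as [[A1 _] [_ B2]].
    apply Rle_antisym; [apply A1; lra|]. apply Rnot_lt_le; intros Hlt. apply B2 in Hlt. lra. }
  intros Ha i j. destruct (Nat.le_ge_cases i j) as [L|L]; pose proof (le_INR _ _ L).
  - rewrite Haux, Rabs_left1 by (auto; lra). ring.
  - rewrite (had_sym H'), Haux, Rabs_right by (auto; lra). ring.
Qed.

Lemma bounded_transfer M : exists n, forall u v, d u v <= M -> d' u v <= INR n * r.
Proof.
  destruct (nat_above (M / r)) as [n Hn].
  apply Rmult_lt_compat_r with (r := r) in Hn; [|lra].
  replace (M / r * r) with M in Hn by (field; lra).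
  exists n. intros u v Huv. apply HA. lra.
Qed.

(** The value at x is below m r exactly if d x (a n) < (n + m) r for some n, a condition on balls
    that both metrics share. *)
Lemma busemann_level a x m : nat_ray d r a ->
  busemann d r a x < INR m * r -> busemann d' r a x < INR m * r.
Proof.
  intros Ha Hlt.
  destruct (proj2 (busemann_spec H a x Ha) (INR m * r - busemann d r a x)) as [n Hn]; [lra|].
  assert (d x (a n) < INR (n + m) * r) as Hd by (rewrite plus_INR; lra).
  apply HA in Hd. rewrite plus_INR in Hd.
  pose proof (busemann_le H' a x n (nat_ray_transfer a Ha)). lra.
Qed.

End Transfer.

Section Transfer2.
Context {X : Type} {d d' : X -> X -> R} (H : hadamard d) (H' : hadamard d').
Context {r : R} (Hr : 0 < r) (HA : same_balls r d d').

(** Advancing the ray by t moves the level of z to a multiple m r, where [busemann_level] separates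
    x from z; for d' the advanced ray changes the Busemann function only by a constant. *)
Lemma busemann_lt_transfer a x z : nat_ray d r a ->
  busemann d r a x < busemann d r a z -> busemann d' r a x < busemann d' r a z.
Proof.
  intros Ha Hlt.
  destruct (half_line_of_ray H r a Hr Ha) as [g [Hg Hga]].
  set (s := busemann d r a z) in *.
  destruct (nat_above (s / r)) as [m Hm].
  apply Rmult_lt_compat_r with (r := r) in Hm; [|lra].
  replace (s / r * r) with s in Hm by (field; lra).
  set (t := INR m * r - s). assert (Ht : 0 < t) by (unfold t; lra).
  set (c := fun n => g (INR n * r + t)).
  assert (Hp : forall n, 0 <= INR n * r) by (intros n; pose proof (pos_INR n); nra).
  assert (Hc : nat_ray d r c).
  { intros i j. unfold c. pose proof (Hp i). pose proof (Hp j).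
    destruct (Rle_dec (INR i) (INR j)) as [L|L].
    - rewrite Hg, Rabs_left1 by nra. ring.
    - rewrite (had_sym H), Hg, Rabs_right by nra. ring. }
  assert (Hac : forall n, d (a n) (c n) <= t).
  { intros n. rewrite <- Hga. unfold c. rewrite Hg; specialize (Hp n); lra. }
  assert (Hc0 : busemann d r c (a 0%nat) = t).
  { apply (busemann_unique H _ _ _ Hc). rewrite <- Hga. simpl. split.
    - intros n. unfold c. specialize (Hp n). rewrite Hg; lra.
    - intros e He. exists 0%nat. unfold c. simpl. rewrite Hg; lra. }
  assert (Hshift : forall y, busemann d r c y = busemann d r a y + t).
  { intros y. pose proof (busemann_diff H Hr a c t y (a 0%nat) Ha Hc Hac) as E.
    rewrite Hc0, (busemann_on_ray H Hr a 0 Ha) in E. simpl in E. lra. }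
  assert (L1 : busemann d' r c x < INR m * r).
  { apply (busemann_level H H' HA); auto. rewrite Hshift. unfold t. lra. }
  assert (L2 : INR m * r <= busemann d' r c z).
  { apply Rnot_lt_le; intros Hlt'.
    apply (busemann_level H' H (same_balls_sym _ _ _ HA)) in Hlt';
      [|apply (nat_ray_transfer H' HA); exact Hc].
    rewrite Hshift in Hlt'. fold s in Hlt'. unfold t in Hlt'. lra. }
  destruct (bounded_transfer Hr HA t) as [n Hn].
  assert (Hac' : forall k, d' (a k) (c k) <= INR n * r) by (intros k; apply Hn; apply Hac).
  pose proof (nat_ray_transfer H' HA a Ha) as Ha'.
  pose proof (nat_ray_transfer H' HA c Hc) as Hc'.
  pose proof (busemann_diff H' Hr a c _ x z Ha' Hc' Hac'). lra.
Qed.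

End Transfer2.

(** * The function F with b' = F o b *)

Section Reparametrization.
Context {X : Type} {d d' : X -> X -> R} (H : hadamard d) (H' : hadamard d').
Context {r : R} (Hr : 0 < r) (HA : same_balls r d d').

Lemma busemann_lt_iff a x z : nat_ray d r a ->
  busemann d r a x < busemann d r a z <-> busemann d' r a x < busemann d' r a z.
Proof.
  intros Ha. split; [apply (busemann_lt_transfer H H' Hr HA); exact Ha|].
  apply (busemann_lt_transfer H' H Hr (same_balls_sym _ _ _ HA)).
  apply (nat_ray_transfer H' HA); exact Ha.
Qed.

(** These are the lifts, fixing 0, of orientation preserving homeomorphisms of the circle R / rZ. *)
Record reparametrization (F : R -> R) : Prop := {
  rep_zero : F 0 = 0;
  rep_incr : forall s t, s < t -> F s < F t;
  rep_period : forall s, F (s + r) = F s + r;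
  rep_surj : forall v, exists s, F s = v
}.

(** The point g (- s) has d-Busemann value s, so this is the d'-value belonging to s. *)
Definition rep (g : R -> X) (s : R) : R := busemann d' r (samples r g) (g (- s)).

Lemma busemann_rep g x : geod_line d g ->
  busemann d' r (samples r g) x = rep g (busemann d r (samples r g) x).
Proof.
  intros Hg. pose proof (samples_ray Hr g Hg) as Ha. unfold rep.
  set (s := busemann d r (samples r g) x).
  assert (E : busemann d r (samples r g) (g (- s)) = s) by (rewrite (busemann_on_line H Hr); auto; ring).
  apply Rle_antisym; apply Rnot_lt_le; intros Hlt; apply (busemann_lt_iff _ _ _ Ha) in Hlt;
    rewrite E in Hlt; unfold s in Hlt; lra.
Qed.

(** The shifted line has g (- s - r) and g (- s) among its samples, so its own d'-Busemann function
    drops by r between them; that of g differs from it by a constant. *)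
Lemma rep_periodic g s : geod_line d g -> rep g (s + r) = rep g s + r.
Proof.
  intros Hg. unfold rep.
  set (c := samples r (fun t => g (t + (- s - r)))).
  pose proof (samples_ray Hr g Hg) as Ha.
  assert (Hc : nat_ray d r c) by (apply (samples_ray Hr), (shift_line g); exact Hg).
  assert (Hac : forall n, d (samples r g n) (c n) <= Rabs (s + r)).
  { intros n. unfold c, samples. rewrite Hg. apply Req_le. f_equal; ring. }
  destruct (bounded_transfer Hr HA (Rabs (s + r))) as [n Hn].
  pose proof (nat_ray_transfer H' HA _ Ha) as Ha'.
  pose proof (nat_ray_transfer H' HA _ Hc) as Hc'.
  pose proof (busemann_diff H' Hr (samples r g) c _ (c 0%nat) (c 1%nat) Ha' Hc'
                (fun k => Hn _ _ (Hac k))) as E.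
  rewrite (busemann_on_ray H' Hr c 0 Hc'), (busemann_on_ray H' Hr c 1 Hc') in E.
  unfold c, samples at 2 4 in E. simpl in E.
  replace (0 * r + (- s - r)) with (- (s + r)) in E by ring.
  replace (1 * r + (- s - r)) with (- s) in E by ring. lra.
Qed.

Lemma rep_reparametrization g : geod_line d g -> reparametrization (rep g).
Proof.
  intros Hg. pose proof (samples_ray Hr g Hg) as Ha. pose proof (nat_ray_transfer H' HA _ Ha) as Ha'.
  constructor.
  - unfold rep. rewrite Ropp_0.
    pose proof (busemann_on_ray H' Hr (samples r g) 0 Ha') as E. unfold samples at 2 in E.
    simpl in E. rewrite Rmult_0_l, Ropp_0 in E. exact E.
  - intros s t Hst. unfold rep. apply (busemann_lt_iff _ _ _ Ha).
    rewrite !(busemann_on_line H Hr) by exact Hg. lra.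
  - intros s. apply rep_periodic; exact Hg.
  (* The d'-half-line through the samples takes all values v <= 0; for v > 0 it is started m r
     earlier, with m r > v. *)
  - intros v. destruct (half_line_of_ray H' r _ Hr Ha') as [h [Hh Hha]].
    destruct (Rle_dec v 0) as [L|L].
    + exists (busemann d r (samples r g) (h (- v))). rewrite <- busemann_rep by exact Hg.
      apply (busemann_unique H' _ _ _ Ha'). split.
      * intros n. rewrite <- Hha. pose proof (pos_INR n).
        destruct (Rle_dec (- v) (INR n * r)).
        -- rewrite Hh by lra. lra.
        -- rewrite (had_sym H'), Hh by nra. lra.
      * intros e He. destruct (nat_above (- v / r)) as [n Hn].
        apply Rmult_lt_compat_r with (r := r) in Hn; [|lra].
        replace (- v / r * r) with (- v) in Hn by (field; lra).
        exists n. rewrite <- Hha, Hh by lra. lra.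
    + destruct (nat_above (v / r)) as [m Hm].
      apply Rmult_lt_compat_r with (r := r) in Hm; [|lra].
      replace (v / r * r) with v in Hm by (field; lra).
      set (g' := fun t => g (t + - (INR m * r))).
      assert (Hg' : geod_line d g') by (apply shift_line; exact Hg).
      pose proof (samples_ray Hr g' Hg') as Hb. pose proof (nat_ray_transfer H' HA _ Hb) as Hb'.
      destruct (half_line_of_ray H' r _ Hr Hb') as [k [Hk Hka]].
      set (x := k (INR m * r - v)).
      exists (busemann d r (samples r g) x). rewrite <- busemann_rep by exact Hg.
      assert (E : busemann d' r (samples r g') x = v - INR m * r).
      { apply (busemann_unique H' _ _ _ Hb'). split.
        - intros n. rewrite <- Hka. unfold x. pose proof (pos_INR n).
          destruct (Rle_dec (INR m * r - v) (INR n * r)).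
          + rewrite Hk by lra. lra.
          + rewrite (had_sym H'), Hk by nra. lra.
        - intros e He. exists m. rewrite <- Hka. unfold x. rewrite Hk by lra. lra. }
      pose proof (busemann_tail H' _ m x Hb') as T. rewrite E in T.
      replace (v - INR m * r + INR m * r) with v in T by ring. rewrite <- T.
      f_equal. apply functional_extensionality. intros n. unfold samples, g'. f_equal.
      rewrite plus_INR. ring.
Qed.

End Reparametrization.

Arguments rep_zero {r F}. Arguments rep_incr {r F}. Arguments rep_period {r F}.
Arguments rep_surj {r F}.
Arguments reparametrization r F : clear implicits.

(** * Increasing bijections of the line that commute with a translation *)

Section Reparam.
Context {r : R} (Hr : 0 < r) {F : R -> R} (HF : reparametrization r F).

Definition congruent (r x y : R) : Prop :=
  exists n, y = x + INR n * r \/ x = y + INR n * r.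

Lemma congruent_in_period x lo : exists y, lo <= y <= lo + r /\ congruent r x y.
Proof.
  destruct (Rle_dec x lo) as [L|L].
  - destruct (nat_floor ((lo - x) / r)) as [n [N1 N2]].
    { apply Rmult_le_reg_r with r; [lra|]. unfold Rdiv. rewrite Rmult_assoc, Rinv_l; lra. }
    apply Rmult_le_compat_r with (r := r) in N1; [|lra].
    apply Rmult_lt_compat_r with (r := r) in N2; [|lra].
    replace ((lo - x) / r * r) with (lo - x) in * by (field; lra).
    exists (x + INR (S n) * r). rewrite S_INR. split; [lra|].
    exists (S n). left. rewrite S_INR. ring.
  - destruct (nat_floor ((x - lo) / r)) as [n [N1 N2]].
    { apply Rmult_le_reg_r with r; [lra|]. unfold Rdiv. rewrite Rmult_assoc, Rinv_l; lra. }
    apply Rmult_le_compat_r with (r := r) in N1; [|lra].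
    apply Rmult_lt_compat_r with (r := r) in N2; [|lra].
    replace ((x - lo) / r * r) with (x - lo) in * by (field; lra).
    exists (x - INR n * r). split; [lra|]. exists n. right. ring.
Qed.

Lemma rep_period_nat s n : F (s + INR n * r) = F s + INR n * r.
Proof.
  induction n as [|n IH]; [simpl; rewrite Rmult_0_l, !Rplus_0_r; reflexivity|].
  rewrite S_INR. replace (s + (INR n + 1) * r) with (s + INR n * r + r) by ring.
  rewrite (rep_period HF), IH. ring.
Qed.

Lemma rep_congruent x y t : congruent r x y -> F (y + t) - F y = F (x + t) - F x.
Proof.
  intros [n [->| ->]].
  - replace (x + INR n * r + t) with (x + t + INR n * r) by ring. rewrite !rep_period_nat. ring.
  - replace (y + INR n * r + t) with (y + t + INR n * r) by ring. rewrite !rep_period_nat. ring.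
Qed.

Lemma rep_mono s t : s <= t -> F s <= F t.
Proof.
  intros Hst. destruct (Req_dec s t) as [->|Hne]; [lra|].
  assert (F s < F t) by (apply (rep_incr HF); lra). lra.
Qed.

Lemma rep_bound s : Rabs (F s - s) <= r.
Proof.
  destruct (congruent_in_period s 0) as [y [Hy Hc]].
  assert (E : F s - s = F y - y).
  { destruct Hc as [n [->| ->]]; rewrite rep_period_nat; ring. }
  rewrite E. assert (F 0 <= F y <= F r) by (split; apply rep_mono; lra).
  pose proof (rep_period HF 0) as P. rewrite Rplus_0_l in P.
  pose proof (rep_zero HF). apply Rabs_le_between. lra.
Qed.

Lemma rep_continuous s e : 0 < e ->
  exists del, 0 < del /\ forall t, Rabs (t - s) < del -> Rabs (F t - F s) < e.
Proof.
  intros He. destruct (rep_surj HF (F s - e)) as [s1 E1].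
  destruct (rep_surj HF (F s + e)) as [s2 E2].
  assert (L1 : s1 < s).
  { apply Rnot_le_lt; intros L. apply rep_mono in L. lra. }
  assert (L2 : s < s2).
  { apply Rnot_le_lt; intros L. apply rep_mono in L. lra. }
  exists (Rmin (s - s1) (s2 - s)). split; [apply Rmin_glb_lt; lra|].
  intros t Ht. apply Rabs_lt_between in Ht.
  pose proof (Rmin_l (s - s1) (s2 - s)). pose proof (Rmin_r (s - s1) (s2 - s)).
  assert (F s1 < F t) by (apply (rep_incr HF); lra).
  assert (F t < F s2) by (apply (rep_incr HF); lra).
  apply Rabs_lt_between. lra.
Qed.

Lemma rep_uniformly_continuous e : 0 < e ->
  exists del, 0 < del /\ forall s t, 0 <= t - s <= del -> F t - F s <= e.
Proof.
  intros He.
  (* Two periods, so that a step of length at most r starting in [0, r] stays inside. *)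
  destruct (Heine_cor2 (f := F) (a := 0) (b := 2 * r)) with (eps := mkposreal e He) as [del Hdel].
  { intros x _ eps Heps. destruct (rep_continuous x eps Heps) as [del [Hd Hc]].
    exists del. split; [exact Hd|]. intros y [_ Hy]. apply Hc. exact Hy. }
  simpl in Hdel. pose proof (cond_pos del) as Hp.
  pose proof (Rmin_l (del / 2) r). pose proof (Rmin_r (del / 2) r).
  exists (Rmin (del / 2) r). split; [apply Rmin_glb_lt; lra|].
  intros s t Hst. destruct (congruent_in_period s 0) as [y [Hy Hc]].
  pose proof (rep_congruent s y (t - s) Hc) as E.
  replace (s + (t - s)) with t in E by ring. rewrite <- E.
  assert (Rabs (F (y + (t - s)) - F y) < e) as HB.
  { apply Hdel; try lra. apply Rabs_lt_between. lra. }
  apply Rabs_lt_between in HB. lra.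
Qed.

(** F (n s) - n s = n (F s - s) stays bounded by r for all n. *)
Lemma rep_additive : (forall s t, F (s + t) = F s + F t) -> forall s, F s = s.
Proof.
  intros Hadd s. assert (Hn : forall n, F (INR n * s) = INR n * F s).
  { induction n as [|n IH].
    - simpl. rewrite !Rmult_0_l. apply (rep_zero HF).
    - rewrite S_INR. replace ((INR n + 1) * s) with (INR n * s + s) by ring.
      rewrite Hadd, IH. ring. }
  apply Rminus_diag_uniq. apply NNPP; intros Hne.
  assert (Hp : 0 < Rabs (F s - s)) by (apply Rabs_pos_lt; exact Hne).
  destruct (nat_above (r / Rabs (F s - s))) as [n Hlt].
  apply Rmult_lt_compat_r with (r := Rabs (F s - s)) in Hlt; [|exact Hp].
  replace (r / Rabs (F s - s) * Rabs (F s - s)) with r in Hlt by (field; lra).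
  pose proof (rep_bound (INR n * s)) as B. rewrite Hn in B.
  replace (INR n * F s - INR n * s) with (INR n * (F s - s)) in B by ring.
  rewrite Rabs_mult, (Rabs_right (INR n)) in B by (apply Rle_ge, pos_INR). lra.
Qed.

(** Differences of the given translations are arbitrarily small ones commuting with F, and their
    multiples reach every positive c. *)
Lemma rep_id_of_periods lo hi : lo < hi ->
  (forall c, lo < c < hi -> forall x, F (x + c) = F x + c) -> forall s, F s = s.
Proof.
  intros Hlh Hc.
  assert (Hsmall : forall c, 0 < c < (hi - lo) / 2 -> forall x, F (x + c) = F x + c).
  { intros c Hcs x. set (m := lo + (hi - lo) / 4).
    pose proof (Hc m ltac:(unfold m; lra) (x - m)) as E1.
    pose proof (Hc (m + c) ltac:(unfold m; lra) (x - m)) as E2.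
    replace (x - m + m) with x in E1 by ring.
    replace (x - m + (m + c)) with (x + c) in E2 by ring. lra. }
  assert (Hpos : forall c x, 0 < c -> F (x + c) = F x + c).
  { intros c x Hcp. destruct (nat_above (2 * c / (hi - lo))) as [n Hn].
    apply Rmult_lt_compat_r with (r := (hi - lo)) in Hn; [|lra].
    replace (2 * c / (hi - lo) * (hi - lo)) with (2 * c) in Hn by (field; lra).
    assert (Hn0 : 0 < INR n).
    { destruct n; [simpl in Hn; lra|]. apply lt_0_INR; lia. }
    set (e := c / INR n). assert (Ee : INR n * e = c) by (unfold e; field; lra).
    assert (He : 0 < e < (hi - lo) / 2).
    { split; [unfold e; apply Rdiv_lt_0_compat; lra|].
      apply Rmult_lt_reg_l with (INR n); lra. }
    assert (Hk : forall k, F (x + INR k * e) = F x + INR k * e).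
    { induction k as [|k IH]; [simpl; rewrite Rmult_0_l, !Rplus_0_r; reflexivity|].
      rewrite S_INR. replace (x + (INR k + 1) * e) with (x + INR k * e + e) by ring.
      rewrite Hsmall, IH by exact He. ring. }
    rewrite <- Ee. apply Hk. }
  intros s. destruct (Rtotal_order s 0) as [L|[->|L]].
  - pose proof (Hpos (- s) s ltac:(lra)) as E.
    replace (s + - s) with 0 in E by ring. rewrite (rep_zero HF) in E. lra.
  - apply (rep_zero HF).
  - pose proof (Hpos s 0 L) as E. rewrite Rplus_0_l, (rep_zero HF) in E. lra.
Qed.

End Reparam.

(** * Asymptotic slopes of b yield translations commuting with F *)

Section Slopes.
Context {X : Type} {d d' : X -> X -> R} (H : hadamard d) (H' : hadamard d').
Context {r : R} (Hr : 0 < r) (HA : same_balls r d d').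

Lemma dist_mult_transfer n x y : d x y = INR n * r -> d' x y = INR n * r.
Proof.
  intros E. destruct (HA n x y) as [[A1 _] [_ B2]].
  apply Rle_antisym; [apply A1; lra|]. apply Rnot_lt_le; intros Hlt. apply B2 in Hlt. lra.
Qed.

(** Points of a d-line at spacing c r have d'-distances c r and 2 c r, so consecutive triples lie on
    d'-geodesics although h need not be a d'-line. *)
Lemma samples_convex (f : X -> R) h t c :
  geod_convex d' f -> geod_line d h -> (1 <= c)%nat ->
  forall k, 2 * f (h (t + INR (S k) * (INR c * r))) <=
    f (h (t + INR k * (INR c * r))) + f (h (t + INR (S (S k)) * (INR c * r))).
Proof.
  intros Hf Hh Hc k. assert (Hc0 : 0 < INR c) by (apply lt_0_INR; lia).
  assert (D1 : d' (h (t + INR k * (INR c * r))) (h (t + INR (S k) * (INR c * r))) = INR c * r).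
  { apply dist_mult_transfer. rewrite (line_dist h), S_INR; auto; [ring|]. rewrite S_INR; nra. }
  assert (D2 : d' (h (t + INR (S k) * (INR c * r))) (h (t + INR (S (S k)) * (INR c * r))) = INR c * r).
  { apply dist_mult_transfer. rewrite (line_dist h), !S_INR; auto; [ring|]. rewrite !S_INR; nra. }
  assert (D3 : d' (h (t + INR k * (INR c * r))) (h (t + INR (S (S k)) * (INR c * r))) = INR c * r + INR c * r).
  { replace (INR c * r + INR c * r) with (INR (c + c) * r) by (rewrite plus_INR; ring).
    apply dist_mult_transfer. rewrite (line_dist h), !S_INR, plus_INR; auto; [ring|].
    rewrite !S_INR; nra. }
  pose proof (Hf _ _ _ _ _ D1 D2 D3) as C.
  apply Rmult_le_reg_l with (INR c * r); nra.
Qed.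

Lemma samples_first (f : X -> R) h t c n :
  geod_convex d' f -> geod_line d h -> (1 <= c)%nat ->
  INR n * (f (h (t + INR c * r)) - f (h t)) <= f (h (t + INR n * (INR c * r))) - f (h t).
Proof.
  intros Hf Hh Hc.
  pose proof (convex_seq_first (fun k => f (h (t + INR k * (INR c * r))))
                (samples_convex f h t c Hf Hh Hc) n) as C.
  cbv beta in C. change (INR 1) with 1 in C. change (INR 0) with 0 in C.
  rewrite Rmult_0_l, Rplus_0_r, Rmult_1_l in C. exact C.
Qed.

Context (g : R -> X) (Hg : geod_line d g).

Local Notation b := (busemann d r (samples r g)).
Local Notation b' := (busemann d' r (samples r g)).
Local Notation F := (rep (d' := d') (r := r) g).

Let Hray : nat_ray d r (samples r g) := samples_ray Hr g Hg.
Let Hray' : nat_ray d' r (samples r g) := nat_ray_transfer H' HA _ Hray.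
Let HF : reparametrization r F := rep_reparametrization H H' Hr HA g Hg.
Let HbF : forall x, b' x = F (b x) := fun x => busemann_rep H H' Hr HA g x Hg.

Lemma busemann_close x y : b' x - b' y <= b x - b y + 2 * r.
Proof.
  rewrite !HbF.
  pose proof (rep_bound Hr HF (b x)) as B1. pose proof (rep_bound Hr HF (b y)) as B2.
  apply Rabs_le_between in B1. apply Rabs_le_between in B2. lra.
Qed.

Lemma busemann_line_convex h : geod_line d h -> convex_fun (fun s => b (h s)).
Proof. intros Hh. apply (convex_on_line d); [apply (busemann_convex H); exact Hray | exact Hh]. Qed.

Lemma busemann_line_cont h lo hi : geod_line d h -> cont_on (fun s => b (h s)) lo hi.
Proof.
  intros Hh. apply lipschitz_cont_on with 1; [lra|]. intros s t _ _. rewrite Rmult_1_l.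
  apply Rabs_le_between.
  pose proof (busemann_lipschitz H _ (h s) (h t) Hray) as L1.
  pose proof (busemann_lipschitz H _ (h t) (h s) Hray) as L2.
  rewrite (Hh s t), <- Rabs_Ropp in L1. replace (- (s - t)) with (t - s) in L1 by ring.
  rewrite (Hh t s) in L2. lra.
Qed.

Definition approx_slope (m : R) : Prop :=
  forall e L0, 0 < e -> exists L h, L0 <= L /\ 0 < L /\ geod_line d h /\
    forall s, 0 <= s <= L -> Rabs (b (h s) - b (h 0) - m * s) <= e * L.

(** For t with b (h t) congruent to x, the increments of b and b' from h t to h (t + r) serve as del
    and w. By convexity each lies between the averages over K steps backward and forward, and these
    are close to m r because b' - b varies by at most 2r. *)
Lemma approx_slope_increment m x tol : m <> 0 -> approx_slope m -> 0 < tol ->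
  exists del w, F (x + del) = F x + w /\ Rabs (del - m * r) <= tol /\ Rabs (w - m * r) <= tol.
Proof.
  intros Hm HW Htol.
  assert (Hm0 : 0 < Rabs m) by (apply Rabs_pos_lt; exact Hm).
  (* The first bound makes b run through a full period over the middle third of [0, L]; the second
     keeps the averaged error below tol. *)
  set (e := Rmin (Rabs m / 12) (tol / (24 * r))).
  assert (He : 0 < e) by (apply Rmin_glb_lt; apply Rdiv_lt_0_compat; lra).
  assert (He1 : e <= Rabs m / 12) by apply Rmin_l.
  assert (He2 : e * (24 * r) <= tol).
  { assert (e <= tol / (24 * r)) as He2 by apply Rmin_r.
    apply Rmult_le_compat_r with (r := 24 * r) in He2; [|lra].
    replace (tol / (24 * r) * (24 * r)) with tol in He2 by (field; lra). exact He2. }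
  destruct (HW e (6 * r + 6 * r / Rabs m + 24 * r * r / tol) He) as (L & h & HL & HL0 & Hh & Hlin).
  assert (P1 : 0 < 6 * r / Rabs m) by (apply Rdiv_lt_0_compat; lra).
  assert (P2 : 0 < 24 * r * r / tol) by (apply Rdiv_lt_0_compat; nra).
  assert (HL1 : 6 * r <= L * Rabs m).
  { replace (6 * r) with (6 * r / Rabs m * Rabs m) by (field; lra).
    apply Rmult_le_compat_r; lra. }
  assert (HL2 : 24 * r * r <= L * tol).
  { replace (24 * r * r) with (24 * r * r / tol * tol) by (field; lra).
    apply Rmult_le_compat_r; lra. }
  set (u := fun s => b (h s)) in *.
  assert (Hlin2 : forall s t, 0 <= s <= L -> 0 <= t <= L -> u t - u s <= m * (t - s) + 2 * (e * L)).
  { intros s t Hs Ht. pose proof (Hlin s Hs) as A1. pose proof (Hlin t Ht) as A2.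
    apply Rabs_le_between in A1. apply Rabs_le_between in A2. unfold u. lra. }
  assert (Ht : exists t, L / 3 <= t <= 2 * L / 3 /\ congruent r x (u t)).
  { assert (HeL : e * L <= Rabs m / 12 * L) by (apply Rmult_le_compat_r; lra).
    pose proof (Hlin2 (L / 3) (2 * L / 3) ltac:(lra) ltac:(lra)) as U1.
    pose proof (Hlin2 (2 * L / 3) (L / 3) ltac:(lra) ltac:(lra)) as U2.
    pose proof (busemann_line_cont h (L / 3) (2 * L / 3) Hh) as Hcont.
    destruct (Rcase_abs m) as [Hneg|Hpos'].
    - rewrite (Rabs_left m) in * by lra.
      destruct (congruent_in_period Hr x (u (2 * L / 3))) as [y [Hy Hc]].
      destruct (ivt_dec u (L / 3) (2 * L / 3) y) as [t [Ht Et]]; [lra|exact Hcont|lra|].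
      exists t. rewrite Et. auto.
    - rewrite (Rabs_right m) in * by lra.
      destruct (congruent_in_period Hr x (u (L / 3))) as [y [Hy Hc]].
      destruct (ivt u (L / 3) (2 * L / 3) y) as [t [Ht Et]]; [lra|exact Hcont|lra|].
      exists t. rewrite Et. auto. }
  destruct Ht as [t [Ht Hcong]].
  (* K steps of length r fit into [0, L] on either side of t. *)
  destruct (nat_floor (L / (3 * r))) as [K [K1 K2]].
  { apply Rlt_le, Rdiv_lt_0_compat; lra. }
  apply Rmult_le_compat_r with (r := 3 * r) in K1; [|lra].
  apply Rmult_lt_compat_r with (r := 3 * r) in K2; [|lra].
  replace (L / (3 * r) * (3 * r)) with L in K1, K2 by (field; lra).
  assert (HK : L <= INR K * (6 * r)) by lra.
  assert (HK0 : 0 < INR K) by nra.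
  assert (Hbig : 2 * (e * L) + 2 * r <= tol * INR K).
  { apply Rmult_le_reg_r with (6 * r); [lra|].
    assert (e * (24 * r) * L <= tol * L) by (apply Rmult_le_compat_r; lra).
    assert (tol * L <= tol * (INR K * (6 * r))) by (apply Rmult_le_compat_l; lra).
    nra. }
  assert (HKr : 0 < INR K * r) by nra.
  assert (Uf : u (t + INR K * r) - u t <= m * (INR K * r) + 2 * (e * L))
    by (pose proof (Hlin2 t (t + INR K * r) ltac:(lra) ltac:(lra)); lra).
  assert (Ub : u (t - INR K * r) - u t <= - (m * (INR K * r)) + 2 * (e * L))
    by (pose proof (Hlin2 t (t - INR K * r) ltac:(lra) ltac:(lra)); lra).
  set (del := u (t + r) - u t). set (w := b' (h (t + r)) - b' (h t)).
  exists del, w.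
  assert (Hsplit : forall z, INR K * (z - m * r) <= 2 * (e * L) + 2 * r ->
            - (2 * (e * L) + 2 * r) <= INR K * (z - m * r) -> Rabs (z - m * r) <= tol).
  { intros z Z1 Z2. apply Rabs_le_between. split; apply Rmult_le_reg_l with (INR K); lra. }
  split; [|split].
  - pose proof (rep_congruent HF x (u t) del Hcong) as E.
    unfold w. rewrite !HbF. fold (u t) (u (t + r)).
    replace (u t + del) with (u (t + r)) in E by (unfold del; ring). lra.
  - pose proof (busemann_line_convex h Hh) as Hcv. fold u in Hcv.
    pose proof (convex_chords u t (t + r) t (t + INR K * r) Hcv) as C1.
    pose proof (convex_chords u (t - INR K * r) t t (t + r) Hcv) as C2.
    assert (1 <= INR K).
    { destruct K; [simpl in HK0; lra|]. rewrite S_INR. pose proof (pos_INR K); lra. }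
    specialize (C1 ltac:(lra) ltac:(lra) ltac:(lra) ltac:(nra)).
    specialize (C2 ltac:(lra) ltac:(lra) ltac:(lra) ltac:(lra)).
    fold del in C1, C2.
    replace (t + INR K * r - t) with (INR K * r) in C1 by ring.
    replace (t + r - t) with r in C1, C2 by ring.
    replace (t - (t - INR K * r)) with (INR K * r) in C2 by ring.
    apply Hsplit; apply Rmult_le_reg_r with r; nra.
  - pose proof (busemann_convex H' _ Hray') as Hcv.
    pose proof (samples_first b' h t 1 K Hcv Hh ltac:(lia)) as C1.
    pose proof (samples_first b' (fun s => h (- s)) (- t) 1 K Hcv (flip_line h Hh) ltac:(lia)) as C2.
    pose proof (samples_convex b' h (t - r) 1 Hcv Hh ltac:(lia) 0) as C3.
    change (INR 1) with 1 in *. change (INR 0) with 0 in C3. change (INR 2) with (1 + 1) in C3.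
    rewrite !Rmult_1_l in *. cbv beta in C2.
    replace (- (- t + r)) with (t - r) in C2 by ring.
    replace (- (- t + INR K * r)) with (t - INR K * r) in C2 by ring.
    replace (- - t) with t in C2 by ring.
    replace (t - r + r) with t in C3 by ring.
    replace (t - r + 0 * r) with (t - r) in C3 by ring.
    replace (t - r + (1 + 1) * r) with (t + r) in C3 by ring.
    pose proof (busemann_close (h (t + INR K * r)) (h t)) as B1.
    pose proof (busemann_close (h (t - INR K * r)) (h t)) as B2.
    unfold u in Uf, Ub.
    assert (INR K * (b' (h t) - b' (h (t - r))) <= INR K * w)
      by (apply Rmult_le_compat_l; [lra|unfold w; lra]).
    fold w in C1. apply Hsplit; nra.
Qed.

Lemma slope_is_period m : m <> 0 -> approx_slope m -> forall x, F (x + m * r) = F x + m * r.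
Proof.
  intros Hm HW x. apply Rminus_diag_uniq. apply NNPP; intros Hne.
  set (gap := Rabs (F (x + m * r) - (F x + m * r))).
  assert (Hgap : 0 < gap) by (apply Rabs_pos_lt; exact Hne).
  destruct (rep_continuous HF (x + m * r) (gap / 2)) as [del0 [Hd0 Hc0]]; [lra|].
  set (tol := Rmin (del0 / 2) (gap / 2)).
  assert (Ht : 0 < tol) by (apply Rmin_glb_lt; lra).
  assert (Ht1 : tol <= del0 / 2) by apply Rmin_l. assert (Ht2 : tol <= gap / 2) by apply Rmin_r.
  destruct (approx_slope_increment m x tol Hm HW Ht) as (del & w & E & D1 & D2).
  specialize (Hc0 (x + del)). replace (x + del - (x + m * r)) with (del - m * r) in Hc0 by ring.
  specialize (Hc0 ltac:(lra)).
  apply Rabs_lt_between in Hc0. apply Rabs_le_between in D2. rewrite E in Hc0.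
  unfold gap, Rabs in *. destruct (Rcase_abs (F (x + m * r) - (F x + m * r))); lra.
Qed.

End Slopes.

(** * Slopes of Busemann functions *)

Section Interpolation.
Context {X : Type} {d : X -> X -> R} (H : hadamard d) {r : R} (Hr : 0 < r).
Context (g : R -> X) (Hg : geod_line d g).

Local Notation b := (busemann d r (samples r g)).

Let Hray : nat_ray d r (samples r g) := samples_ray Hr g Hg.

Definition long_slopes (delta : R) : Prop :=
  forall L0, exists L h, L0 <= L /\ 0 < L /\ geod_line d h /\
    forall s t, 0 <= s <= t -> t <= L ->
      (-1 + delta) * (t - s) <= b (h t) - b (h s) <= (1 - delta) * (t - s).

(** Unlike in [approx_slope], the slope m may depend on e and L0; no limit slope is extracted. *)
Definition almost_affine (delta : R) : Prop :=
  forall e L0, 0 < e -> exists L h m, L0 <= L /\ 0 < L /\ geod_line d h /\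
    -1 + delta <= m <= 1 - delta /\
    forall s, 0 <= s <= L -> Rabs (b (h s) - b (h 0) - m * s) <= e * L.

Lemma small_increment (f : nat -> R) N e :
  f N - f 0%nat < INR N * e -> exists i, (i < N)%nat /\ f (S i) - f i <= e.
Proof.
  intros Hf. apply NNPP; intros Hn.
  assert (Hk : forall k, (k <= N)%nat -> INR k * e <= f k - f 0%nat).
  { induction k as [|k IH]; intros Hk; [simpl; lra|].
    specialize (IH ltac:(lia)). rewrite S_INR.
    assert (e < f (S k) - f k); [|lra].
    apply Rnot_le_lt; intros Hle. apply Hn. exists k. split; [lia|exact Hle]. }
  specialize (Hk N ltac:(lia)). lra.
Qed.

(* The slope of a convex function is monotone and here stays in [-1,1], so on one of
   many consecutive blocks it hardly changes. *)
Lemma almost_affine_of_long_slopes delta : 0 < delta -> long_slopes delta -> almost_affine delta.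
Proof.
  intros Hdelta HLS e L0 He.
  (* The chord slopes of the blocks vary by less than 2 < N e, so some pair of neighbours differs by
     at most e; these two blocks form the segment. *)
  destruct (nat_above (2 / e)) as [N HN].
  apply Rmult_lt_compat_r with (r := e) in HN; [|lra].
  replace (2 / e * e) with 2 in HN by (field; lra).
  set (l := Rmax L0 1). assert (Hl1 : 1 <= l) by apply Rmax_r.
  assert (HlL : L0 <= l) by apply Rmax_l.
  destruct (HLS (INR (N + 2) * l)) as (Lw & h & HLw & HLw0 & Hh & Hs).
  set (u := fun s => b (h s)).
  assert (Hcv : convex_fun u)
    by (apply (convex_on_line d); [apply (busemann_convex H); exact Hray | exact Hh]).
  set (sg := fun i => (u (INR (S i) * l) - u (INR i * l)) / l).
  assert (Hsgl : forall i, sg i * l = u (INR (S i) * l) - u (INR i * l))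
    by (intros i; unfold sg; field; lra).
  assert (Hsg : forall i, (i <= N)%nat -> -1 + delta <= sg i <= 1 - delta).
  { intros i Hi.
    assert (INR (S i) * l <= Lw).
    { apply Rle_trans with (INR (N + 2) * l); [|exact HLw].
      apply Rmult_le_compat_r; [lra|]. apply le_INR; lia. }
    pose proof (pos_INR i).
    assert (0 <= INR i * l <= INR (S i) * l) by (rewrite S_INR; nra).
    pose proof (Hs (INR i * l) (INR (S i) * l)) as B. specialize (B ltac:(lra) ltac:(lra)).
    replace (INR (S i) * l - INR i * l) with l in B by (rewrite S_INR; ring).
    specialize (Hsgl i). unfold u in Hsgl. rewrite <- Hsgl in B.
    split; apply Rmult_le_reg_r with l; lra. }
  destruct (small_increment sg N e) as [i [Hi Hse]].
  { pose proof (Hsg N ltac:(lia)). pose proof (Hsg 0%nat ltac:(lia)). lra. }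
  exists (2 * l), (fun s => h (s + INR i * l)), (sg i).
  split; [lra|]. split; [lra|]. split; [apply shift_line; exact Hh|].
  split; [apply Hsg; lia|].
  intros s Hs2. rewrite Rplus_0_l. change (Rabs (u (s + INR i * l) - u (INR i * l) - sg i * s) <= e * (2 * l)).
  pose proof (Hsgl i) as E1. pose proof (Hsgl (S i)) as E2. rewrite !S_INR in *.
  set (A := INR i * l) in *.
  replace ((INR i + 1) * l) with (A + l) in * by (unfold A; ring).
  replace ((INR i + 1 + 1) * l) with (A + 2 * l) in * by (unfold A; ring).
  replace (s + A) with (A + s) by ring.
  assert (Hel : (sg (S i) - sg i) * l <= e * l) by (apply Rmult_le_compat_r; lra).
  apply Rabs_le_between.
  destruct (Rle_dec s l) as [Hsl|Hsl].
  - pose proof (Hcv A (A + s) (A + l) ltac:(lra)) as C1.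
    pose proof (Hcv (A + s) (A + l) (A + 2 * l) ltac:(lra)) as C2.
    assert (B : (sg (S i) - sg i) * (l - s) <= e * l).
    { destruct (Rle_dec (sg (S i) - sg i) 0); [nra|].
      apply Rle_trans with ((sg (S i) - sg i) * l); [|exact Hel]. apply Rmult_le_compat_l; lra. }
    split; apply Rmult_le_reg_l with l; nra.
  - pose proof (Hcv A (A + l) (A + s) ltac:(lra)) as C1.
    pose proof (Hcv (A + l) (A + s) (A + 2 * l) ltac:(lra)) as C2.
    assert (B : (sg (S i) - sg i) * (s - l) <= e * l).
    { destruct (Rle_dec (sg (S i) - sg i) 0); [nra|].
      apply Rle_trans with ((sg (S i) - sg i) * l); [|exact Hel]. apply Rmult_le_compat_l; lra. }
    split; apply Rmult_le_reg_l with l; nra.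
Qed.

(* The triangle with vertices p = h 0, q = h L and the point at infinity of [g] is almost
   flat, so on the segment from p to a point q' of the ray from q to infinity b is almost
   affine too; moving q' makes its slope run from m down to -1. *)
Lemma approx_slope_interpolation delta m' :
  0 < delta < 1 -> almost_affine delta -> -1 < m' < -1 + delta ->
  approx_slope (d := d) (r := r) g m'.
Proof.
  intros Hdelta HAA Hm' e L0 He.
  set (e1 := e * delta / 4). assert (He1 : 0 < e1) by (unfold e1; nra).
  set (L1 := Rmax (2 * L0 / delta) 1).
  destruct (HAA e1 L1 He1) as (L & h & m & HL & HL0 & Hh & Hm & Hlin).
  assert (HL2 : 2 * L0 <= delta * L).
  { assert (2 * L0 / delta <= L) as HL' by (unfold L1 in HL; pose proof (Rmax_l (2 * L0 / delta) 1); lra).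
    apply Rmult_le_compat_l with (r := delta) in HL'; [|lra].
    replace (delta * (2 * L0 / delta)) with (2 * L0) in HL' by (field; lra). exact HL'. }
  set (p := h 0) in *. set (q := h L) in *.
  assert (Hpq : d p q = L) by (unfold p, q; rewrite line_dist; auto; lra).
  set (amax := 2 / (1 + m')).
  assert (Ham : amax * (1 + m') = 2) by (unfold amax; field; lra).
  assert (Ham0 : 0 < amax) by (unfold amax; apply Rdiv_lt_0_compat; lra).
  destruct (busemann_approx H _ q (e1 * L) Hray ltac:(nra)) as [N HN].
  destruct (nat_above ((amax * L + d q (g 0)) / r)) as [N2 HN2].
  apply Rmult_lt_compat_r with (r := r) in HN2; [|lra].
  replace ((amax * L + d q (g 0)) / r * r) with (amax * L + d q (g 0)) in HN2 by (field; lra).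
  set (n := Nat.max N N2). specialize (HN n ltac:(lia)).
  set (x := samples r g n) in *.
  assert (Hqx : amax * L <= d q x).
  { assert (INR N2 * r <= INR n * r) by (apply Rmult_le_compat_r; [lra|]; apply le_INR; lia).
    assert (d (g 0) x = INR n * r).
    { unfold x, samples. rewrite line_dist; auto; [ring|]. pose proof (pos_INR n); nra. }
    pose proof (had_tri H (g 0) q x). rewrite (had_sym H (g 0) q) in *. lra. }
  destruct (had_line H q x) as [z [Hz [z0 z1]]].
  assert (Hbz : forall a, 0 <= a <= d q x -> b (z a) <= b q + e1 * L - a).
  { intros a Ha. pose proof (busemann_le H _ (z a) n Hray) as B. fold x in B.
    rewrite <- z1 in B. rewrite line_dist in B; auto; lra. }
  (* Along z the function b falls at almost unit rate, so f a = 0 says that b has mean slope about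
     m' from p to z (a L); amax makes f nonpositive. *)
  set (f := fun a => (m - a) * L - m' * d p (z (a * L))).
  assert (Hf0 : 0 <= f 0).
  { unfold f. rewrite Rmult_0_l, z0, Hpq. nra. }
  assert (Hf1 : f amax <= 0).
  { unfold f. pose proof (had_tri H p q (z (amax * L))) as T.
    rewrite <- z0 in T at 2. rewrite (line_dist z 0), Hpq in T; auto; [|nra]. nra. }
  destruct (ivt_dec f 0 amax 0) as [a [Ha Hfa]]; [lra| |lra|].
  { apply lipschitz_cont_on with (L + L); [lra|]. intros s t _ _. unfold f.
    pose proof (dist_rev_tri d H p (z (t * L)) (z (s * L))) as R1. rewrite Hz in R1.
    replace (t * L - s * L) with ((t - s) * L) in R1 by ring.
    rewrite Rabs_mult, (Rabs_right L) in R1 by lra.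
    replace ((m - t) * L - m' * d p (z (t * L)) - ((m - s) * L - m' * d p (z (s * L))))
      with (- ((t - s) * L) + (- m') * (d p (z (t * L)) - d p (z (s * L)))) by ring.
    eapply Rle_trans; [apply Rabs_triang|].
    rewrite Rabs_Ropp, !Rabs_mult, (Rabs_right L), (Rabs_right (- m')) by lra.
    pose proof (Rabs_pos (d p (z (t * L)) - d p (z (s * L)))). nra. }
  unfold f in Hfa. set (q' := z (a * L)) in *. set (l := d p q') in *.
  assert (HaL : 0 <= a * L <= d q x) by nra.
  assert (Hqq : d q q' = a * L) by (rewrite <- z0; unfold q'; rewrite line_dist; auto; lra).
  (* The new segment is comparable in length to the old one, so an error e1 L is also small relative
     to l. *)
  assert (Hl : delta * L <= 2 * l).
  { pose proof (had_tri H p q' q) as T. rewrite Hpq, (had_sym H q' q), Hqq in T. fold l in T.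
    pose proof (had_pos H p q') as Hpos. fold l in Hpos. nra. }
  assert (Hl0 : 0 < l) by nra.
  destruct (had_line H p q') as [k [Hk [k0 k1]]]. fold l in k1.
  exists l, k. split; [lra|]. split; [lra|]. split; [exact Hk|].
  intros s Hs. rewrite k0.
  set (lam := s / l). assert (Elam : lam * l = s) by (unfold lam; field; lra).
  assert (Hlam : 0 <= lam <= 1).
  { split; apply Rmult_le_reg_r with l; lra. }
  assert (Hms : m' * s = lam * ((m - a) * L)).
  { rewrite <- Elam. replace ((m - a) * L) with (m' * l) by lra. ring. }
  (* Comparison with the point of h at the same ratio bounds b (k s) from below; convexity bounds it
     from above. *)
  assert (Hthales : d (k s) (h (lam * L)) <= lam * (a * L)).
  { rewrite <- Hqq, (had_sym H q q').
    apply (thales d H p q' q); auto; fold l.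
    - rewrite <- k0, line_dist; auto; lra.
    - rewrite <- k1, line_dist; auto; lra.
    - rewrite Hpq. unfold p. rewrite line_dist; auto; nra.
    - rewrite Hpq. unfold q. rewrite line_dist; auto; nra. }
  pose proof (Hlin (lam * L) ltac:(nra)) as B1. pose proof (Hlin L ltac:(lra)) as B2.
  fold q in B2. apply Rabs_le_between in B1. apply Rabs_le_between in B2.
  pose proof (busemann_lipschitz H _ (h (lam * L)) (k s) Hray) as B3.
  rewrite (had_sym H (h (lam * L))) in B3.
  specialize (Hbz (a * L) HaL). fold q' in Hbz.
  pose proof (busemann_convex H _ Hray p q' (k s) s (l - s)) as B4.
  specialize (B4 ltac:(rewrite <- k0, line_dist; auto; lra)
                 ltac:(rewrite <- k1, line_dist; auto; lra) ltac:(fold l; ring)).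
  replace (s + (l - s)) with l in B4 by ring.
  assert (B5 : b (k s) <= b p + lam * (b q' - b p)).
  { apply Rmult_le_reg_l with l; [lra|]. rewrite <- Elam in B4 at 2 3. nra. }
  assert (B6 : lam * (b q' - b p) <= lam * ((m - a) * L + 2 * (e1 * L)))
    by (apply Rmult_le_compat_l; lra).
  assert (B7 : 2 * (e1 * L) <= e * l).
  { unfold e1. assert (e * (delta * L) <= e * (2 * l)) by (apply Rmult_le_compat_l; lra). lra. }
  assert (B8 : lam * (2 * (e1 * L)) <= 2 * (e1 * L)).
  { assert (0 <= e1 * L) by nra. nra. }
  rewrite Hms. apply Rabs_le_between. split; nra.
Qed.

End Interpolation.

Lemma eq_of_close (a b : R) : (forall e, 0 < e -> Rabs (a - b) <= e) -> a = b.
Proof.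
  intros He. apply Rminus_diag_uniq. apply NNPP; intros Hne.
  assert (Hp : 0 < Rabs (a - b)) by (apply Rabs_pos_lt; exact Hne).
  specialize (He (Rabs (a - b) / 2)). lra.
Qed.

Lemma pos_nat_above (x : R) : exists n : nat, (1 <= n)%nat /\ x <= INR n.
Proof.
  destruct (nat_above x) as [n Hn]. exists (S n). rewrite S_INR. split; [lia | lra].
Qed.

(** * F is the identity *)

Section Identity.
Context {X : Type} {d d' : X -> X -> R} (H : hadamard d) (H' : hadamard d').
Context {r : R} (Hr : 0 < r) (HA : same_balls r d d') (HC : connected_at_infinity d).

Local Notation bus g := (busemann d r (samples r g)).
Local Notation bus' g := (busemann d' r (samples r g)).
Local Notation F g := (rep (d' := d') (r := r) g).
Local Notation flip g := (fun s : R => g (- s)).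

Lemma rep_id_of_long_slopes g delta :
  geod_line d g -> 0 < delta < 1 -> long_slopes (d := d) (r := r) g delta ->
  forall s, F g s = s.
Proof.
  intros Hg Hdelta HL.
  pose proof (rep_reparametrization H H' Hr HA g Hg) as HF.
  apply (rep_id_of_periods HF (- r) ((-1 + delta) * r)); [nra|].
  intros c Hc x.
  assert (Ec : c = c / r * r) by (field; lra).
  rewrite Ec. apply (slope_is_period H H' Hr HA g Hg).
  - intros E. rewrite E in Ec. nra.
  - apply (approx_slope_interpolation H Hr g Hg delta); [lra | |].
    + apply (almost_affine_of_long_slopes H Hr g Hg); [lra | exact HL].
    + split; apply Rmult_lt_reg_r with r; lra.
Qed.

(** The reversed line and its shift by s bound a strip for d'; minus the d'-Busemann function of g
    drops by exactly j r along both, so [strip_increment_abs] with k = 0 and j large gives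
    equality. *)
Lemma rep_flip g s : geod_line d g -> F (flip g) s = - F g (- s).
Proof.
  intros Hg.
  pose proof (rep_reparametrization H H' Hr HA g Hg) as HF.
  set (a := samples r (flip g)). set (c := samples r (fun t => g (s - t))).
  assert (Hm : geod_line d (fun t => g (s - t))).
  { intros u v. rewrite Hg, <- Rabs_Ropp. f_equal; ring. }
  pose proof (nat_ray_transfer H' HA _ (samples_ray Hr _ (flip_line g Hg))) as Ha. fold a in Ha.
  pose proof (nat_ray_transfer H' HA _ (samples_ray Hr _ Hm)) as Hc. fold c in Hc.
  pose proof (nat_ray_transfer H' HA _ (samples_ray Hr _ Hg)) as Hray'.
  destruct (bounded_transfer Hr HA (Rabs s)) as [M HM].
  assert (Hac : forall n, d' (a n) (c n) <= INR M * r).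
  { intros n. apply HM. unfold a, c, samples. rewrite Hg, <- Rabs_Ropp.
    apply Req_le. f_equal. ring. }
  apply eq_of_close. intros e He.
  destruct (pos_nat_above ((INR M * r) ^ 2 / (2 * r * e))) as [j [Hj1 Hj]].
  assert (HjR : 1 <= INR j) by (change 1 with (INR 1); apply le_INR; exact Hj1).
  assert (HK : (INR M * r) ^ 2 <= INR j * (2 * r * e)).
  { apply Rmult_le_compat_r with (r := 2 * r * e) in Hj; [|nra].
    replace ((INR M * r) ^ 2 / (2 * r * e) * (2 * r * e)) with ((INR M * r) ^ 2) in Hj by (field; lra).
    exact Hj. }
  assert (Hval : forall t, bus' g (g t) = F g (- t)).
  { intros t. unfold rep. rewrite Ropp_involutive. reflexivity. }
  assert (Va : forall n, bus' g (a n) = INR n * r).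
  { intros n. unfold a, samples at 2. rewrite Hval, Ropp_involutive.
    pose proof (rep_period_nat HF 0 n) as E.
    rewrite Rplus_0_l, (rep_zero HF), Rplus_0_l in E. exact E. }
  assert (Vc : forall n, bus' g (c n) = F g (- s) + INR n * r).
  { intros n. unfold c, samples at 2. rewrite Hval, <- (rep_period_nat HF). f_equal. ring. }
  assert (Es : F (flip g) s = busemann d' r a (c 0%nat)).
  { unfold rep, c, samples at 2. rewrite Ropp_involutive. fold a. f_equal. f_equal. simpl; ring. }
  rewrite Es.
  pose proof (strip_increment_abs H' Hr (fun x => - bus' g x) a c (INR M * r) 0 j Ha Hc Hac) as S.
  cbv beta in S. rewrite !Va, !Vc in S. change (INR 0) with 0 in S.
  eapply Rle_trans; [|eapply Rle_trans; [apply S|]].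
  - apply Req_le. rewrite <- Rabs_Ropp. f_equal. ring.
  - intros y z. pose proof (busemann_lipschitz H' _ z y Hray') as L. rewrite (had_sym H') in L. lra.
  - exact Hj1.
  - lra.
  - lra.
  - rewrite Rplus_0_r. apply Rmult_le_reg_r with (2 * (INR j * r)); [nra|].
    unfold Rdiv. rewrite Rmult_assoc, Rinv_l by nra. lra.
Qed.

Lemma busemann_path_cont a c : nat_ray d r a -> d_path d c -> cont_on (fun t => busemann d r a (c t)) 0 1.
Proof.
  intros Ha Hc s Hs e He. destruct (Hc s Hs e He) as [del [Hdel Hd]].
  exists del; split; [exact Hdel|]. intros t Ht Hts. specialize (Hd t Ht Hts).
  pose proof (busemann_lipschitz H a (c t) (c s) Ha).
  pose proof (busemann_lipschitz H a (c s) (c t) Ha).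
  rewrite (had_sym H (c t)) in *. apply Rabs_lt_between. lra.
Qed.

(** The difference of the two Busemann functions is -2 R1 at g R1 and 2 R1 at g (- R1), and these
    points are joined by a path far from g 0. *)
Lemma far_point_between_ends g p rho :
  geod_line d g -> exists y, rho <= d (g 0) y /\ bus g y - bus (flip g) y = p.
Proof.
  intros Hg. set (R1 := Rabs rho + Rabs p + 1).
  pose proof (Rle_abs rho). pose proof (Rle_abs p). pose proof (Rle_abs (- p)) as Hp.
  rewrite Rabs_Ropp in Hp. pose proof (Rabs_pos rho). pose proof (Rabs_pos p).
  assert (HR1 : 0 < R1) by (unfold R1; lra).
  assert (E1 : d (g 0) (g R1) = R1) by (rewrite line_dist; auto; lra).
  assert (E2 : d (g 0) (g (- R1)) = R1) by (rewrite (had_sym H), line_dist; auto; lra).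
  destruct (outer_path (d := d) (g 0) R1 (g R1) (g (- R1))) as [c [Hc [c0 [c1 Hfar]]]]; auto; try lra.
  pose proof (samples_ray Hr _ Hg) as Ha. pose proof (samples_ray Hr _ (flip_line g Hg)) as Hb.
  assert (V1 : forall s, bus g (g s) = - s) by (intros s; apply (busemann_on_line H Hr); exact Hg).
  assert (V2 : forall s, bus (flip g) (g s) = s).
  { intros s. pose proof (busemann_on_line H Hr (flip g) (- s) (flip_line g Hg)) as E.
    cbv beta in E. rewrite Ropp_involutive in E. exact E. }
  destruct (ivt (fun t => bus g (c t) - bus (flip g) (c t)) 0 1 p) as [t [Ht Et]]; [lra| | |].
  - intros s Hs e He.
    destruct (busemann_path_cont _ c Ha Hc s Hs (e / 2) ltac:(lra)) as [d1 [D1 C1]].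
    destruct (busemann_path_cont _ c Hb Hc s Hs (e / 2) ltac:(lra)) as [d2 [D2 C2]].
    exists (Rmin d1 d2). split; [apply Rmin_glb_lt; lra|]. intros t Ht Hts.
    pose proof (Rmin_l d1 d2). pose proof (Rmin_r d1 d2).
    specialize (C1 t Ht ltac:(lra)). specialize (C2 t Ht ltac:(lra)).
    apply Rabs_lt_between in C1. apply Rabs_lt_between in C2. apply Rabs_lt_between. lra.
  - rewrite c0, c1, !V1, !V2. unfold R1. lra.
  - exists (c t). split; [|exact Et]. specialize (Hfar t Ht). unfold R1 in Hfar. lra.
Qed.

Lemma late_slopes g delta : geod_line d g -> 0 < delta <= 1 / 2 ->
  ~ long_slopes (d := d) (r := r) g delta ->
  exists L0, 0 < L0 /\ forall h s, geod_line d h -> bus g (h 0) = 0 -> 0 < s -> - (s / 8) <= bus g (h s) ->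
    forall c e, 3 * s / 4 + L0 <= c -> c <= e -> (1 - delta) * (e - c) <= bus g (h e) - bus g (h c).
Proof.
  intros Hg Hdelta Hn.
  assert (Hex : exists L0, forall L h, L0 <= L -> 0 < L -> geod_line d h ->
     exists s t, 0 <= s <= t /\ t <= L /\
      ~ ((-1 + delta) * (t - s) <= bus g (h t) - bus g (h s) <= (1 - delta) * (t - s))).
  { apply NNPP; intros Hno. apply Hn. intros L0. apply NNPP; intros Hno2. apply Hno.
    exists L0. intros L h HL HL0 Hh. apply NNPP; intros Hno3. apply Hno2.
    exists L, h. repeat split; auto; apply NNPP; intros Hno4; apply Hno3; exists s, t;
      (split; [assumption|]); (split; [assumption|]); tauto. }
  destruct Hex as [L0 HL0].
  pose proof (Rmax_l L0 1). pose proof (Rmax_r L0 1).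
  exists (Rmax L0 1). split; [lra|].
  intros h s Hh Hh0 Hs Hus c e Hc Hce.
  set (u := fun t => bus g (h t)) in *.
  pose proof (samples_ray Hr _ Hg) as Ha.
  assert (Hcv : convex_fun u)
    by (apply (convex_on_line d); [apply (busemann_convex H); exact Ha | exact Hh]).
  (* A steeper descent after 3s/4 would by convexity put u (3s/4) below -3s/8, but it is at least -
     s/8 - s/4. Hence the exceptional slope on the segment following 3s/4 exceeds 1 - delta, and
     convexity preserves this later on. *)
  assert (Hlow : forall t1 t2, 3 * s / 4 <= t1 -> t1 < t2 -> (-1 + delta) * (t2 - t1) <= u t2 - u t1).
  { intros t1 t2 Ht1 Ht12. apply Rnot_lt_le; intros Hlt.
    pose proof (convex_chords u 0 (3 * s / 4) t1 t2 Hcv ltac:(lra) ltac:(lra) ltac:(lra) ltac:(lra)) as C.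
    assert (U0 : u 0 = 0) by exact Hh0. rewrite U0 in C.
    assert (U1 : u (3 * s / 4) < (-1 + delta) * (3 * s / 4)).
    { apply Rmult_lt_reg_r with (t2 - t1); [lra|]. nra. }
    pose proof (busemann_lipschitz H _ (h s) (h (3 * s / 4)) Ha) as L.
    rewrite (had_sym H), line_dist in L; auto; [|lra]. unfold u in U1. nra. }
  destruct (HL0 (Rmax L0 1) (fun t => h (t + 3 * s / 4)) ltac:(lra) ltac:(lra)
              (shift_line h _ Hh)) as (t1 & t2 & T1 & T2 & Hnot).
  change (~ ((-1 + delta) * (t2 - t1) <= u (t2 + 3 * s / 4) - u (t1 + 3 * s / 4) <= (1 - delta) * (t2 - t1))) in Hnot.
  assert (Hlt : t1 < t2).
  { destruct (Req_dec t1 t2) as [E|E]; [|lra]. exfalso. apply Hnot. rewrite E. lra. }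
  pose proof (Hlow (t1 + 3 * s / 4) (t2 + 3 * s / 4) ltac:(lra) ltac:(lra)) as Hl.
  replace (t2 + 3 * s / 4 - (t1 + 3 * s / 4)) with (t2 - t1) in Hl by ring.
  assert (Hup : (1 - delta) * (t2 - t1) < u (t2 + 3 * s / 4) - u (t1 + 3 * s / 4)) by lra.
  change ((1 - delta) * (e - c) <= u e - u c).
  destruct (Req_dec c e) as [->|Hne]; [lra|].
  pose proof (convex_chords u (t1 + 3 * s / 4) (t2 + 3 * s / 4) c e Hcv ltac:(lra) ltac:(lra) ltac:(lra) ltac:(lra)) as C.
  replace (t2 + 3 * s / 4 - (t1 + 3 * s / 4)) with (t2 - t1) in C by ring.
  apply Rmult_le_reg_r with (t2 - t1); [lra|]. nra.
Qed.

(** The last of l steps of length j r has the largest increment of b', hence at least the average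
    one; passing from b to b' costs 2r, spread over the l steps. *)
Lemma late_increments g h delta s j l :
  geod_line d g -> geod_line d h -> (1 <= j)%nat -> (1 <= l)%nat ->
  (1 - delta) * (INR l * (INR j * r)) <= bus g (h s) - bus g (h (s - INR l * (INR j * r))) ->
  INR j * r - (delta * (INR j * r) + 2 * r / INR l) <= bus' g (h s) - bus' g (h (s - INR j * r)).
Proof.
  intros Hg Hh Hj Hl Hu.
  pose proof (nat_ray_transfer H' HA _ (samples_ray Hr _ Hg)) as Ha'.
  pose proof (samples_first Hr HA (bus' g) (flip h) (- s) j l
                (busemann_convex H' _ Ha') (flip_line h Hh) Hj) as C.
  cbv beta in C.
  replace (- (- s + INR j * r)) with (s - INR j * r) in C by ring.
  replace (- (- s + INR l * (INR j * r))) with (s - INR l * (INR j * r)) in C by ring.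
  replace (- - s) with s in C by ring.
  pose proof (busemann_close H H' Hr HA g Hg (h (s - INR l * (INR j * r))) (h s)) as B.
  assert (Hl0 : 0 < INR l) by (apply lt_0_INR; lia).
  apply Rmult_le_reg_l with (INR l); [lra|].
  replace (INR l * (INR j * r - (delta * (INR j * r) + 2 * r / INR l)))
    with ((1 - delta) * (INR l * (INR j * r)) - 2 * r) by (field; lra).
  lra.
Qed.

Lemma increments_agree g p err :
  geod_line d g -> 0 < err ->
  (forall delta, 0 < delta < 1 -> ~ long_slopes (d := d) (r := r) g delta) ->
  (forall delta, 0 < delta < 1 -> ~ long_slopes (d := d) (r := r) (flip g) delta) ->
  exists x1, forall t, 0 <= t <= r ->
    Rabs ((F g (x1 + t) - F g x1) - (F (flip g) (x1 - p + t) - F (flip g) (x1 - p))) <= 8 * err.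
Proof.
  intros Hg Herr Hn1 Hn2.
  pose proof (flip_line g Hg) as Hm.
  pose proof (rep_reparametrization H H' Hr HA g Hg) as HF1.
  pose proof (rep_reparametrization H H' Hr HA (flip g) Hm) as HF2.
  destruct (rep_uniformly_continuous Hr HF1 err Herr) as [del1 [D1 U1]].
  destruct (rep_uniformly_continuous Hr HF2 err Herr) as [del2 [D2 U2]].
  destruct (pos_nat_above (r / (2 * err))) as [j [Hj1 Hj]].
  destruct (pos_nat_above (2 * r / err)) as [l [Hl1 Hl]].
  assert (HjR : 1 <= INR j) by (change 1 with (INR 1); apply le_INR; exact Hj1).
  assert (HlR : 1 <= INR l) by (change 1 with (INR 1); apply le_INR; exact Hl1).
  assert (Ej : r ^ 2 / (2 * (INR j * r)) <= err).
  { apply Rmult_le_compat_r with (r := 2 * err) in Hj; [|lra].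
    replace (r / (2 * err) * (2 * err)) with r in Hj by (field; lra).
    apply Rmult_le_reg_r with (2 * (INR j * r)); [nra|].
    replace (r ^ 2 / (2 * (INR j * r)) * (2 * (INR j * r))) with (r ^ 2) by (field; lra). nra. }
  assert (El : 2 * r / INR l <= err).
  { apply Rmult_le_compat_r with (r := err) in Hl; [|lra].
    replace (2 * r / err * err) with (2 * r) in Hl by (field; lra).
    apply Rmult_le_reg_r with (INR l); [lra|].
    replace (2 * r / INR l * INR l) with (2 * r) by (field; lra). lra. }
  (* The slope defect delta costs at most err over j r, and at most the continuity moduli del1, del2
     over r. *)
  set (delta := Rmin (1 / 2) (Rmin (err / (INR j * r)) (Rmin (del1 / r) (del2 / r)))).
  assert (Hdelta : 0 < delta).
  { repeat apply Rmin_glb_lt; try lra; apply Rdiv_lt_0_compat; try lra; nra. }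
  assert (Hd1 : delta <= 1 / 2) by apply Rmin_l.
  assert (Hd2 : delta * (INR j * r) <= err).
  { assert (delta <= err / (INR j * r)) as L
      by (eapply Rle_trans; [apply Rmin_r | apply Rmin_l]).
    apply Rmult_le_compat_r with (r := INR j * r) in L; [|nra].
    replace (err / (INR j * r) * (INR j * r)) with err in L by (field; lra). exact L. }
  assert (Hd3 : delta * r <= del1).
  { assert (delta <= del1 / r) as L
      by (eapply Rle_trans; [apply Rmin_r | eapply Rle_trans; [apply Rmin_r | apply Rmin_l]]).
    apply Rmult_le_compat_r with (r := r) in L; [|lra].
    replace (del1 / r * r) with del1 in L by (field; lra). exact L. }
  assert (Hd4 : delta * r <= del2).
  { assert (delta <= del2 / r) as L
      by (eapply Rle_trans; [apply Rmin_r | eapply Rle_trans; [apply Rmin_r | apply Rmin_r]]).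
    apply Rmult_le_compat_r with (r := r) in L; [|lra].
    replace (del2 / r * r) with del2 in L by (field; lra). exact L. }
  destruct (late_slopes g delta Hg ltac:(lra) (Hn1 delta ltac:(lra))) as [L1 [P1 S1]].
  destruct (late_slopes (flip g) delta Hm ltac:(lra) (Hn2 delta ltac:(lra))) as [L2 [P2 S2]].
  set (W := INR l * (INR j * r)). assert (HW : 0 < W) by (unfold W; apply Rmult_lt_0_compat; nra).
  destruct (far_point_between_ends g p (8 * Rabs p + 4 * (L1 + L2 + W)) Hg) as [y [Hy1 Hy2]].
  pose proof (Rabs_pos p) as Hp. pose proof (Rle_abs p) as Hp1. pose proof (Rle_abs (- p)) as Hp2.
  rewrite Rabs_Ropp in Hp2.
  destruct (had_line H (g 0) y) as [h [Hh [h0 h1]]].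
  set (s := d (g 0) y) in *.
  pose proof (samples_ray Hr _ Hg) as Ha. pose proof (samples_ray Hr _ Hm) as Hb.
  assert (V1 : bus g (h 0) = 0) by (rewrite h0, (busemann_on_line H Hr); auto; ring).
  assert (V2 : bus (flip g) (h 0) = 0).
  { rewrite h0. pose proof (busemann_on_line H Hr (flip g) 0 Hm) as E. cbv beta in E.
    rewrite Ropp_0 in E. exact E. }
  (* With difference p and nonnegative sum, both values at y are at least - |p| / 2, hence at least
     - s/8 as [late_slopes] requires. *)
  assert (Hsum : 0 <= bus g y + bus (flip g) y).
  { apply Rnot_lt_le; intros Hlt.
    set (gap := - (bus g y + bus (flip g) y)).
    destruct (busemann_approx H _ y (gap / 2) Ha ltac:(unfold gap; lra)) as [N1 HN1].
    destruct (busemann_approx H _ y (gap / 2) Hb ltac:(unfold gap; lra)) as [N2 HN2].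
    set (n := Nat.max N1 N2). specialize (HN1 n ltac:(lia)). specialize (HN2 n ltac:(lia)).
    pose proof (had_tri H (samples r g n) y (samples r (flip g) n)) as T.
    rewrite (had_sym H (samples r g n) y) in T.
    assert (d (samples r g n) (samples r (flip g) n) = 2 * (INR n * r)).
    { unfold samples. rewrite (had_sym H), line_dist; auto; [ring|]. pose proof (pos_INR n); nra. }
    unfold gap in *. lra. }
  assert (Hs0 : 0 < s) by lra.
  specialize (S1 h s Hh V1 Hs0 ltac:(rewrite h1; lra)).
  specialize (S2 h s Hh V2 Hs0 ltac:(rewrite h1; lra)).
  exists (bus g y). intros t Ht.
  set (a := samples r (fun u => h (s - u))). set (c := samples r (fun u => h (s + t - u))).
  assert (Hrev : forall w, geod_line d (fun u => h (w - u))).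
  { intros w u v. rewrite Hh, <- Rabs_Ropp. f_equal; ring. }
  pose proof (nat_ray_transfer H' HA _ (samples_ray Hr _ (Hrev s))) as Hra. fold a in Hra.
  pose proof (nat_ray_transfer H' HA _ (samples_ray Hr _ (Hrev (s + t)))) as Hrc. fold c in Hrc.
  assert (Hac : forall n, d' (a n) (c n) <= r).
  { intros n. destruct (HA 1%nat (a n) (c n)) as [[A1 _] _]. change (INR 1) with 1 in A1.
    rewrite Rmult_1_l in A1. apply A1. unfold a, c, samples. rewrite line_dist; auto; lra. }
  set (G := busemann d' r a (c 0%nat)).
  assert (Ea : forall n, a n = h (s - INR n * r)) by reflexivity.
  assert (Ec : forall n, c n = h (s + t - INR n * r)) by reflexivity.
  assert (Ha0 : a 0%nat = h s) by (rewrite Ea; f_equal; simpl; ring).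
  assert (Hc0 : c 0%nat = h (s + t)) by (rewrite Ec; f_equal; simpl; ring).
  (* G, the d'-Busemann value across the strip between the two reversed rays, does not depend on k;
     so it compares the increments of F for g and for its reversal. *)
  assert (Key : forall k, geod_line d k ->
     (forall c e, s - W <= c -> c <= e -> (1 - delta) * (e - c) <= bus k (h e) - bus k (h c)) ->
     (forall u v, 0 <= v - u <= delta * r -> F k v - F k u <= err) ->
     Rabs (F k (bus k y + t) - F k (bus k y) - G) <= 4 * err).
  { intros k Hk Sk Uk.
    pose proof (rep_reparametrization H H' Hr HA k Hk) as HFk.
    pose proof (samples_ray Hr _ Hk) as Hrk.
    pose proof (nat_ray_transfer H' HA _ Hrk) as Hrk'.
    pose proof (late_increments k h delta s j l Hk Hh Hj1 Hl1) as I1.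
    specialize (I1 ltac:(pose proof (Sk (s - W) s ltac:(lra) ltac:(lra)) as B; fold W; lra)).
    pose proof (late_increments k h delta (s + t) j l Hk Hh Hj1 Hl1) as I2.
    specialize (I2 ltac:(pose proof (Sk (s + t - W) (s + t) ltac:(lra) ltac:(lra)) as B; fold W; lra)).
    pose proof (strip_increment_abs H' Hr (bus' k) a c r (2 * err) j Hra Hrc Hac
                  (fun y z => busemann_lipschitz H' _ y z Hrk') Hj1) as S.
    fold G in S. rewrite Ha0, Hc0, (Ea j), (Ec j) in S.
    specialize (S ltac:(lra) ltac:(lra)).
    rewrite !(busemann_rep H H' Hr HA k) in S by exact Hk. rewrite h1 in S.
    pose proof (Sk s (s + t) ltac:(lra) ltac:(lra)) as B1. rewrite h1 in B1.
    pose proof (busemann_lipschitz H _ (h (s + t)) y Hrk) as B2.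
    rewrite <- h1, (had_sym H), line_dist, h1 in B2; auto; [|lra].
    assert (B3 : delta * t <= delta * r) by (apply Rmult_le_compat_l; lra).
    pose proof (Uk (bus k (h (s + t))) (bus k y + t) ltac:(lra)) as B4.
    pose proof (rep_mono HFk (bus k (h (s + t))) (bus k y + t) ltac:(lra)) as B5.
    apply Rabs_le_between in S. apply Rabs_le_between. lra. }
  pose proof (Key g Hg) as K1. pose proof (Key (flip g) Hm) as K2.
  specialize (K1 ltac:(intros c' e' Hc' He'; apply S1; lra) ltac:(intros u v Huv; apply U1; lra)).
  specialize (K2 ltac:(intros c' e' Hc' He'; apply S2; lra) ltac:(intros u v Huv; apply U2; lra)).
  replace (bus g y - p) with (bus (flip g) y) by lra.
  apply Rabs_le_between in K1. apply Rabs_le_between in K2. apply Rabs_le_between. lra.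
Qed.

(** The difference is r-periodic, so its near constancy on the one period given by
    [increments_agree] suffices. *)
Lemma rep_difference_const g p x x' :
  geod_line d g ->
  (forall delta, 0 < delta < 1 -> ~ long_slopes (d := d) (r := r) g delta) ->
  (forall delta, 0 < delta < 1 -> ~ long_slopes (d := d) (r := r) (flip g) delta) ->
  F g x - F (flip g) (x - p) = F g x' - F (flip g) (x' - p).
Proof.
  intros Hg Hn1 Hn2.
  pose proof (rep_reparametrization H H' Hr HA g Hg) as HF1.
  pose proof (rep_reparametrization H H' Hr HA (flip g) (flip_line g Hg)) as HF2.
  apply eq_of_close. intros e He.
  destruct (increments_agree g p (e / 16) Hg ltac:(lra) Hn1 Hn2) as [x1 Hx1].
  assert (Hclose : forall z, Rabs ((F g z - F (flip g) (z - p)) - (F g x1 - F (flip g) (x1 - p))) <= e / 2).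
  { intros z. destruct (congruent_in_period Hr z x1) as [y [Hy Hcong]].
    specialize (Hx1 (y - x1) ltac:(lra)).
    replace (x1 + (y - x1)) with y in Hx1 by ring.
    replace (x1 - p + (y - x1)) with (y - p) in Hx1 by ring.
    assert (E : F g z - F (flip g) (z - p) = F g y - F (flip g) (y - p)).
    { destruct Hcong as [n [->| ->]].
      - replace (z + INR n * r - p) with (z - p + INR n * r) by ring.
        rewrite (rep_period_nat HF1), (rep_period_nat HF2). ring.
      - replace (y + INR n * r - p) with (y - p + INR n * r) by ring.
        rewrite (rep_period_nat HF1), (rep_period_nat HF2). ring. }
    rewrite E. apply Rabs_le_between in Hx1. apply Rabs_le_between. lra. }
  pose proof (Hclose x) as C1. pose proof (Hclose x') as C2.
  apply Rabs_le_between in C1. apply Rabs_le_between in C2. apply Rabs_le_between. lra.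
Qed.

Lemma rep_identity g : geod_line d g -> forall s, F g s = s.
Proof.
  intros Hg. pose proof (flip_line g Hg) as Hm.
  pose proof (rep_reparametrization H H' Hr HA g Hg) as HF.
  pose proof (rep_reparametrization H H' Hr HA (flip g) Hm) as HFm.
  destruct (classic (exists delta, 0 < delta < 1 /\ long_slopes (d := d) (r := r) g delta))
    as [[delta [Hd HL]]|Hn1]; [apply (rep_id_of_long_slopes g delta); auto|].
  destruct (classic (exists delta, 0 < delta < 1 /\ long_slopes (d := d) (r := r) (flip g) delta))
    as [[delta [Hd HL]]|Hn2].
  - intros s. pose proof (rep_flip g (- s) Hg) as E. rewrite Ropp_involutive in E.
    rewrite (rep_id_of_long_slopes (flip g) delta) in E; auto. lra.
  (* The difference constant for p gives F (x + p) = F p + F_- x, and the one for 0 gives F = F_-,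
     where F_- belongs to the reversed line. *)
  - apply (rep_additive Hr HF). intros x p.
    pose proof (rep_difference_const g p (x + p) p Hg) as E1.
    pose proof (rep_difference_const g 0 x 0 Hg) as E2.
    specialize (E1 ltac:(intros e He HL; apply Hn1; eauto) ltac:(intros e He HL; apply Hn2; eauto)).
    specialize (E2 ltac:(intros e He HL; apply Hn1; eauto) ltac:(intros e He HL; apply Hn2; eauto)).
    replace (x + p - p) with x in E1 by ring. replace (p - p) with 0 in E1 by ring.
    rewrite !Rminus_0_r in E2. rewrite (rep_zero HF), (rep_zero HFm) in *. lra.
Qed.

(** Along the d-line through two points b' = b, and b' is 1-Lipschitz for d', so d <= d'. For the
    converse, the d'-line is prolonged to distance n r, where the metrics agree, and d <= d' is used
    on the prolongation. *)
Lemma isometry_of_same_balls x y : d' x y = d x y.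
Proof.
  assert (Hle : forall x y, d x y <= d' x y).
  { intros u v. destruct (had_line H u v) as [g [Hg [g0 g1]]].
    pose proof (nat_ray_transfer H' HA _ (samples_ray Hr _ Hg)) as Ha'.
    pose proof (busemann_lipschitz H' _ u v Ha') as L.
    rewrite !(busemann_rep H H' Hr HA g) in L by exact Hg.
    rewrite !rep_identity in L by exact Hg.
    rewrite <- g0 in L at 1. rewrite <- g1 in L at 1.
    rewrite !(busemann_on_line H Hr) in L by exact Hg. lra. }
  apply Rle_antisym; [|apply Hle].
  destruct (had_line H' x y) as [h [Hh [h0 h1]]]. pose proof (had_pos H' x y).
  destruct (nat_above (d' x y / r)) as [n Hn].
  apply Rmult_lt_compat_r with (r := r) in Hn; [|lra].
  replace (d' x y / r * r) with (d' x y) in Hn by (field; lra).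
  assert (E1 : d' x (h (INR n * r)) = INR n * r)
    by (rewrite <- h0 at 1; rewrite line_dist; auto; lra).
  assert (E2 : d' y (h (INR n * r)) = INR n * r - d' x y)
    by (rewrite <- h1 at 1; rewrite line_dist; auto; lra).
  apply (dist_mult_transfer (same_balls_sym _ _ _ HA)) in E1.
  pose proof (had_tri H x y (h (INR n * r))). pose proof (Hle y (h (INR n * r))). lra.
Qed.

End Identity.

(** * Equivalence of the three conditions with equality of the metrics *)

Lemma same_balls_of_closed {X : Type} (d d' : X -> X -> R) (r : R) :
  hadamard d -> hadamard d' -> 0 < r ->
  (forall x y, d x y <= r <-> d' x y <= r) -> same_balls r d d'.
Proof.
  intros H H' Hr HC n x y.
  assert (HC' : forall x y, d' x y <= r <-> d x y <= r) by (intros u v; symmetry; apply HC).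
  split; split.
  - apply near_chain; auto. apply HC.
  - apply near_chain; auto. apply HC.
  - apply near_chain_lt; auto. apply open_balls_of_closed; auto.
  - apply near_chain_lt; auto. apply open_balls_of_closed; auto.
Qed.

Theorem theorem2 (X : Type) (d d' : X -> X -> R) (r : R) :
  is_metric d -> locally_compact d -> geodesically_complete d -> CAT0 d ->
  connected_at_infinity d ->
  0 < r ->
  is_metric d' -> locally_compact d' -> geodesically_complete d' -> CAT0 d' ->
  let C1 := forall x y : X, d x y <= r <-> d' x y <= r in
  let C2 := forall x y : X, d x y = r <-> d' x y = r in
  let C3 := forall x y : X, d x y < r <-> d' x y < r in
  let E := forall x y : X, d' x y = d x y in
  (C1 <-> C2) /\ (C2 <-> C3) /\
  (E <-> C1) /\ (E <-> C2) /\ (E <-> C3).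
Proof.
  intros Hm _ Hg Hc HC Hr Hm' _ Hg' Hc' C1 C2 C3 E.
  pose proof (hadamard_of_CAT0 d Hm Hg Hc) as H.
  pose proof (hadamard_of_CAT0 d' Hm' Hg' Hc') as H'.
  assert (H1 : C1 -> E).
  { intros HC1 x y. apply (isometry_of_same_balls H H' Hr (same_balls_of_closed d d' r H H' Hr HC1) HC). }
  assert (H2 : C2 -> C1).
  { intros HC2 x y. apply (equal_balls_of_equal_spheres H H' r Hr HC HC2). }
  assert (H3 : C3 -> C1).
  { intros HC3 x y. split; apply (closed_balls_of_open r Hr); auto.
    intros u v; symmetry; apply HC3. }
  assert (E1 : E -> C1) by (intros HE x y; rewrite HE; tauto).
  assert (E2 : E -> C2) by (intros HE x y; rewrite HE; tauto).
  assert (E3 : E -> C3) by (intros HE x y; rewrite HE; tauto).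
  tauto.
Qed.
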